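(* Let $k$ be an algebraically closed field of characteristic $p>2$ and let $d\geq 1$ with $p\mid d$. Then the Schur superalgebra $S(1|1,d)$ is isomorphic (as an algebra) to the algebra $\tilde{\mathcal{A}}_d$, and $S(1|1,d)$ has finite representation type.
   Context: $S(1|1,d)=\operatorname{End}_{k\Sigma_d}(V^{\otimes d})$ where $V$ has an even basis vector $v_1$ and an odd basis vector $v_2$, and $\Sigma_d$ acts on the right on $V^{\otimes d}$ by place permutations with sign: $(\dots\otimes v_{i_j}\otimes v_{i_{j+1}}\otimes\dots)\cdot(j\ j{+}1)=(-1)^{\bar v_{i_j}\bar v_{i_{j+1}}}(\dots\otimes v_{i_{j+1}}\otimes v_{i_j}\otimes\dots)$. For $m\ge1$, $\tilde{\mathcal{A}}_m=k\mathcal{Q}/\mathcal{I}$ where $\mathcal{Q}$ is the quiver with vertices $0,1,\dots,m$ and arrows $\alpha_i:i-1\to i$, $\beta_i:i\to i-1$ for $1\le i\le m$, and $\mathcal{I}$ is the ideal generated by $\alpha_i\alpha_{i+1}=0$, $\beta_{i+1}\beta_i=0$, $\alpha_1\beta_1=0$, $\beta_m\alpha_m=0$, and $\beta_i\alpha_i=\alpha_{i+1}\beta_{i+1}$ for $1\le i\le m-1$ (paths written left to right). *)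

(* Defs.v *)
From HB Require Import structures.
From mathcomp Require Import all_boot all_order all_fingroup all_algebra.

Set Implicit Arguments.
Unset Strict Implicit.
Unset Printing Implicit Defensive.

Import GRing.Theory.
Local Open Scope ring_scope.

(* Part 1: the Schur superalgebra S(1|1,d) = End_{k Sigma_d}(V^{(x)d}).        *)
(* V has basis v_1 (even) and v_2 (odd).  A basis vector of V^{(x)d},         *)
(* v_{i_1} (x) ... (x) v_{i_d}, is encoded by w : {ffun 'I_d -> bool} with    *)
(* w x = false  <->  i_(x+1) = 1 (even)   and   w x = true <-> i_(x+1) = 2     *)
(* (odd).  Vectors of V^{(x)d} are COLUMN vectors of size #|{ffun 'I_d->bool}| *)
(* (written tdim.+1 below, with tidx the enumeration of basis tensors), and a  *)
(* linear endomorphism f is the matrix F with f(x) = F *m x; hence the        *)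
(* product of matrices is the composition of endomorphisms.                    *)

Section Schur.
Variables (k : fieldType) (d : nat).

Definition tensor_basis := {ffun 'I_d -> bool}.

Lemma tensor_card_gt0 : (0 < #|tensor_basis|)%N.
Proof. by rewrite card_ffun card_bool card_ord expn_gt0. Qed.

Definition tdim := #|tensor_basis|.-1.

Definition tidx (r : 'I_tdim.+1) : tensor_basis :=
  enum_val (cast_ord (prednK tensor_card_gt0) r).

(* Matrix of the (right) action of the transposition (i j) by place          *)
(* permutation with sign:  e_w . (i j) = (-1)^(|w_i| |w_j|) e_{w o (i j)}.   *)
Definition swap_sign_mx (i j : 'I_d) : 'M[k]_tdim.+1 :=
  \matrix_(r, c)
    (if tidx r == [ffun x => tidx c (tperm i j x)]
     then (-1) ^+ (tidx c i && tidx c j) else 0).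

(* End_{k Sigma_d}: the endomorphisms commuting with the action of all the    *)
(* simple transpositions (j j+1), which generate Sigma_d.                    *)
Definition schur_pred : {pred 'M[k]_tdim.+1} :=
  [pred F | [forall i : 'I_d, forall j : 'I_d,
     (nat_of_ord j == (nat_of_ord i).+1) ==>
       (F *m swap_sign_mx i j == swap_sign_mx i j *m F)]].

Lemma schur_pred_closed : GRing.subsemialg_closed schur_pred.
Proof.
split.
- by apply/forallP=> i; apply/forallP=> j; apply/implyP=> _;
     rewrite mul1mx mulmx1.
- split.
  + by apply/forallP=> i; apply/forallP=> j; apply/implyP=> _;
       rewrite mul0mx mulmx0.
  + move=> A B /forallP hA /forallP hB; apply/forallP=> i; apply/forallP=> j.
    apply/implyP=> hij.
    have /forallP/(_ j)/implyP/(_ hij)/eqP eA := hA i.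
    have /forallP/(_ j)/implyP/(_ hij)/eqP eB := hB i.
    by rewrite mulmxDl mulmxDr eA eB.
- move=> a A /forallP hA; apply/forallP=> i; apply/forallP=> j.
  apply/implyP=> hij.
  have /forallP/(_ j)/implyP/(_ hij)/eqP eA := hA i.
  by rewrite -scalemxAl -scalemxAr eA.
- move=> A B /forallP hA /forallP hB; apply/forallP=> i; apply/forallP=> j.
  apply/implyP=> hij.
  have /forallP/(_ j)/implyP/(_ hij)/eqP eA := hA i.
  have /forallP/(_ j)/implyP/(_ hij)/eqP eB := hB i.
  by rewrite -mulmxE -mulmxA eB mulmxA eA mulmxA.
Qed.

HB.instance Definition _ :=
  GRing.isSubalgClosed.Build k 'M[k]_tdim.+1 schur_pred schur_pred_closed.

Record schur_superalg := SchurElt {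
  schur_val :> 'M[k]_tdim.+1;
  _ : schur_val \in schur_pred }.

HB.instance Definition _ := [isSub for schur_val].
HB.instance Definition _ := [Choice of schur_superalg by <:].
HB.instance Definition _ := [SubChoice_isSubAlgebra of schur_superalg by <:].

End Schur.

(* A left A-module structure on k^n (row vectors) is given by rho : A ->      *)
(* 'M_n with  a . v := v *m rho a;  the module axioms say that rho is         *)
(* k-linear, unital and  rho (a * b) = rho b *m rho a.                       *)

Section Modules.
Variables (k : fieldType) (A : algType k).

Definition is_module n (rho : A -> 'M[k]_n) : Prop :=
  [/\ forall (c : k) (x y : A), rho (c *: x + y) = c *: rho x + rho y,
      rho 1 = 1%:M
    & forall x y : A, rho (x * y) = rho y *m rho x].

Definition is_submodule n (rho : A -> 'M[k]_n) (U : 'M[k]_n) : Prop :=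
  forall a : A, (U *m rho a <= U)%MS.

Definition decomposable n (rho : A -> 'M[k]_n) : Prop :=
  exists U W : 'M[k]_n,
    [/\ is_submodule rho U, is_submodule rho W,
        (0 < \rank U)%N /\ (0 < \rank W)%N,
        (1%:M <= U + W)%MS & (U :&: W <= (0 : 'M[k]_n))%MS].

Definition indecomposable n (rho : A -> 'M[k]_n) : Prop :=
  (0 < n)%N /\ ~ decomposable rho.

Definition module_iso n1 n2 (rho1 : A -> 'M[k]_n1) (rho2 : A -> 'M[k]_n2)
  : Prop :=
  exists (X : 'M[k]_(n1, n2)) (Y : 'M[k]_(n2, n1)),
    [/\ X *m Y = 1%:M, Y *m X = 1%:M
      & forall a : A, rho1 a *m X = X *m rho2 a].

Definition finite_rep_type : Prop :=
  exists (N : nat) (dim : 'I_N -> nat) (M : forall i : 'I_N, A -> 'M[k]_(dim i)),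
    forall n (rho : A -> 'M[k]_n),
      is_module rho -> indecomposable rho -> exists i : 'I_N, module_iso rho (M i).

End Modules.

(* Part 3: the algebra  ~A_m = kQ / I.                                        *)
(* Vertices 0..m are 'I_m.+1; the arrow alpha_(i+1) : i -> i+1 is a i and    *)
(* beta_(i+1) : i+1 -> i is b i, for i : 'I_m.  Paths are written left to     *)
(* right and the product in kQ is concatenation: p * q = "p then q".          *)
(* kQ/I is the k-algebra generated by the vertex idempotents e_i and the      *)
(* arrows subject to the path-algebra relations (complete set of orthogonal   *)
(* idempotents, arrow x : s -> t satisfies x = e_s x e_t) together with the   *)
(* generators of I.  "A is isomorphic to ~A_m" means that A has elements      *)
(* satisfying these relations with the universal property of kQ/I.           *)

Section TildeA.
Variable k : fieldType.

Definition tildeA_rels (B : algType k) (m : nat)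
    (e : 'I_m.+1 -> B) (a b : 'I_m -> B) : Prop :=
  (forall i j : 'I_m.+1, e i * e j = if i == j then e i else 0) /\
  \sum_(i < m.+1) e i = 1 /\
  (forall i : 'I_m, a i = e (widen_ord (leqnSn m) i) * a i * e (lift ord0 i)) /\
  (forall i : 'I_m, b i = e (lift ord0 i) * b i * e (widen_ord (leqnSn m) i)) /\
  (forall i j : 'I_m, nat_of_ord j = (nat_of_ord i).+1 ->
      a i * a j = 0 /\ b j * b i = 0) /\
  (forall i : 'I_m, nat_of_ord i = 0%N -> a i * b i = 0) /\
  (forall i : 'I_m, (nat_of_ord i).+1 = m -> b i * a i = 0) /\
  (forall i j : 'I_m, nat_of_ord j = (nat_of_ord i).+1 ->
      b i * a i = a j * b j).

Definition is_alg_hom (A B : algType k) (f : A -> B) : Prop :=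
  [/\ forall (c : k) (x y : A), f (c *: x + y) = c *: f x + f y,
      f 1 = 1
    & forall x y : A, f (x * y) = f x * f y].

Definition presents_tildeA (A : algType k) (m : nat)
    (e : 'I_m.+1 -> A) (a b : 'I_m -> A) : Prop :=
  tildeA_rels e a b /\
  forall (B : algType k) (e' : 'I_m.+1 -> B) (a' b' : 'I_m -> B),
    tildeA_rels e' a' b' ->
    exists f : A -> B,
      [/\ is_alg_hom f, f \o e =1 e', f \o a =1 a', f \o b =1 b'
        & forall g : A -> B, is_alg_hom g ->
            g \o e =1 e' -> g \o a =1 a' -> g \o b =1 b' -> g =1 f].

Definition isomorphic_to_tildeA (A : algType k) (m : nat) : Prop :=
  exists (e : 'I_m.+1 -> A) (a b : 'I_m -> A), presents_tildeA e a b.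

End TildeA.

(* Main.v *)
(* Both algebras are generated by weight idempotents E_i and two commuting
   square-zero operators al, be that lower and raise the weight by one, and both
   have the basis E_i al^s be^t (s, t in {0, 1}, boundary terms excluded).  On
   the tensor space, al and be are signed sums over all places of the operators
   turning an odd factor into an even one and conversely; their commutator is
   multiplication by +-d, which vanishes since p divides d.  An element of the
   commutant is determined by its entries at pairs (u, w) of basis tensors up to
   simultaneous place permutations.  Since 2 <> 0, an entry vanishes if two
   places are even in u and odd in w, or two are odd in u and even in w, and
   this leaves exactly the 4d coordinates of the basis above.

   A module is a graded space with operators al and be.  If al be <> 0, it
   contains a 4-dimensional free summand.  If al be = 0, a string v_x, ..., v_b
   with a dual string of functionals, found by walking to the right from the
   lowest nonzero degree, splits off a summand.  In both cases an indecomposable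
   module has a basis of bounded size that every monomial maps to basis vectors
   or 0, and there are finitely many such modules. *)

Require Import Defs.
From HB Require Import structures.
From mathcomp Require Import all_boot all_order all_fingroup all_algebra.
From mathcomp Require Import zify ring.

Set Implicit Arguments.
Unset Strict Implicit.
Unset Printing Implicit Defensive.

Import GRing.Theory.
Local Open Scope ring_scope.

(** * The algebra by generators and relations *)

(* [al] and [be] are the sums of all arrows [a] and [b]; [E] is the family of
   vertex idempotents, extended by [0] so that the shift relations need no
   boundary cases. *)
Record zigzag (k : fieldType) (B : algType k) (m : nat)
    (E : nat -> B) (al be : B) : Prop := Zigzag {
  zz_idem : forall i j, E i * E j = if i == j then E i else 0;
  zz_one : \sum_(i < m.+1) E i = 1;
  zz_out : forall i, (m < i)%N -> E i = 0;
  zz_al : forall i, E i * al = al * E i.+1;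
  zz_al0 : al * E 0%N = 0;
  zz_be : forall i, be * E i = E i.+1 * be;
  zz_be0 : E 0%N * be = 0;
  zz_al2 : al * al = 0;
  zz_be2 : be * be = 0;
  zz_comm : al * be = be * al }.

Section ZigzagFromRelations.
Variables (k : fieldType) (B : algType k) (m : nat).
Variables (e : 'I_m.+1 -> B) (a b : 'I_m -> B).
Hypothesis rels : tildeA_rels e a b.

Definition ext n (f : 'I_n -> B) (i : nat) : B := oapp f 0 (insub i).

Lemma ext_ord n (f : 'I_n -> B) (i : 'I_n) : ext f i = f i.
Proof. by rewrite /ext valK. Qed.

Lemma ext_out n (f : 'I_n -> B) i : (n <= i)%N -> ext f i = 0.
Proof. by move=> h; rewrite /ext insubF // ltnNge h. Qed.

Local Notation E := (ext e).
Local Notation a_ := (ext a).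
Local Notation b_ := (ext b).

Lemma ext_idem i j : E i * E j = if i == j then E i else 0.
Proof.
case: rels => [ee _].
have [hi|hi] := ltnP i m.+1; last first.
  by rewrite ext_out // mul0r if_same.
have [hj|hj] := ltnP j m.+1; last first.
  by rewrite (ext_out _ hj) mulr0; case: eqP => // ->; rewrite ext_out.
by have := ee (Ordinal hi) (Ordinal hj); rewrite -!ext_ord.
Qed.

Lemma ext_a i : a_ i = E i * a_ i * E i.+1.
Proof.
case: rels => [_ [_ [ha _]]].
have [hi|hi] := ltnP i m; last by rewrite ext_out // mulr0 mul0r.
by have := ha (Ordinal hi); rewrite -!ext_ord /= /bump.
Qed.

Lemma ext_b i : b_ i = E i.+1 * b_ i * E i.
Proof.
case: rels => [_ [_ [_ [hb _]]]].
have [hi|hi] := ltnP i m; last by rewrite ext_out // mulr0 mul0r.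
by have := hb (Ordinal hi); rewrite -!ext_ord /= /bump.
Qed.

Lemma ext_aa i : a_ i * a_ i.+1 = 0.
Proof.
case: rels => [_ [_ [_ [_ [h _]]]]].
have [hi|hi] := ltnP i.+1 m; last by rewrite (ext_out _ hi) mulr0.
have [+ _] := h (Ordinal (ltnW hi)) (Ordinal hi) erefl.
by rewrite -!ext_ord.
Qed.

Lemma ext_bb i : b_ i.+1 * b_ i = 0.
Proof.
case: rels => [_ [_ [_ [_ [h _]]]]].
have [hi|hi] := ltnP i.+1 m; last by rewrite (ext_out _ hi) mul0r.
have [_ +] := h (Ordinal (ltnW hi)) (Ordinal hi) erefl.
by rewrite -!ext_ord.
Qed.

Lemma ext_ab0 : a_ 0 * b_ 0 = 0.
Proof.
case: rels => [_ [_ [_ [_ [_ [h _]]]]]].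
have [hi|hi] := ltnP 0 m; last by rewrite (ext_out _ hi) mul0r.
by have := h (Ordinal hi) erefl; rewrite -!ext_ord.
Qed.

(** The relation at the last vertex becomes an instance of the one at inner vertices: for [i.+1 = m]
    the right side vanishes because [a_ m] is 0 by the extension. *)
Lemma ext_ba i : b_ i * a_ i = a_ i.+1 * b_ i.+1.
Proof.
case: rels => [_ [_ [_ [_ [_ [_ [hm h]]]]]]].
have [hi|hi] := ltnP i.+1 m.
  have := h (Ordinal (ltnW hi)) (Ordinal hi) erefl.
  by rewrite -!ext_ord.
rewrite (ext_out a hi) mul0r.
have [hi'|hi'] := ltnP i m; last by rewrite ext_out // mul0r.
have := hm (Ordinal hi'); rewrite -!ext_ord; apply => /=; lia.
Qed.

Lemma ext_Ea i j : E i * a_ j = if i == j then a_ i else 0.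
Proof.
rewrite ext_a !mulrA ext_idem; case: eqP => [->|_]; last by rewrite !mul0r.
by rewrite -ext_a.
Qed.

Lemma ext_aE i j : a_ j * E i = if i == j.+1 then a_ j else 0.
Proof.
rewrite [a_ j]ext_a -!mulrA ext_idem eq_sym.
by case: eqP => [_|_]; rewrite ?mulr0 ?mulrA.
Qed.

Lemma ext_Eb i j : E i * b_ j = if i == j.+1 then b_ j else 0.
Proof.
rewrite ext_b !mulrA ext_idem; case: eqP => [->|_]; last by rewrite !mul0r.
by rewrite -ext_b.
Qed.

Lemma ext_bE i j : b_ j * E i = if i == j then b_ j else 0.
Proof.
rewrite [b_ j]ext_b -!mulrA ext_idem eq_sym.
by case: eqP => [_|_]; rewrite ?mulr0 ?mulrA.
Qed.

Let al := \sum_(i < m) a_ i.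
Let be := \sum_(i < m) b_ i.

Lemma sum_delta (f : nat -> B) (i : nat) : (forall j, (m <= j)%N -> f j = 0) ->
  \sum_(j < m) (if i == j then f j else 0) = f i.
Proof.
move=> fout; have [hi|hi] := ltnP i m.
  rewrite (bigD1 (Ordinal hi)) //= eqxx big1 ?addr0 // => j nj.
  by case: eqP => // ij; case/eqP: nj; apply: val_inj.
rewrite fout // big1 // => j _; case: eqP => // ij.
by move: (ltn_ord j); rewrite -ij; lia.
Qed.

Lemma ext_Eal i : E i * al = a_ i.
Proof.
rewrite mulr_sumr -[RHS](sum_delta (f := a_)); last exact: ext_out.
by apply: eq_bigr => j _; rewrite ext_Ea; case: eqP => // ->.
Qed.

Lemma ext_alE i : al * E i.+1 = a_ i.
Proof.
rewrite mulr_suml -[RHS](sum_delta (f := a_)); last exact: ext_out.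
by apply: eq_bigr => j _; rewrite ext_aE eqSS.
Qed.

Lemma ext_Ebe i : E i.+1 * be = b_ i.
Proof.
rewrite mulr_sumr -[RHS](sum_delta (f := b_)); last exact: ext_out.
by apply: eq_bigr => j _; rewrite ext_Eb eqSS.
Qed.

Lemma ext_beE i : be * E i = b_ i.
Proof.
rewrite mulr_suml -[RHS](sum_delta (f := b_)); last exact: ext_out.
by apply: eq_bigr => j _; rewrite ext_bE.
Qed.

Lemma ext_sum1 : \sum_(i < m.+1) E i = 1.
Proof.
case: rels => [_ [<- _]]; apply: eq_bigr => i _; exact: ext_ord.
Qed.

Lemma ext_al0 : al * E 0 = 0.
Proof. by rewrite mulr_suml big1 // => j _; rewrite ext_aE. Qed.

Lemma ext_be0 : E 0 * be = 0.
Proof. by rewrite mulr_sumr big1 // => j _; rewrite ext_Eb. Qed.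

Lemma zigzag_of_rels : zigzag m E al be.
Proof.
split.
- exact: ext_idem.
- exact: ext_sum1.
- by move=> i hi; rewrite ext_out.
- by move=> i; rewrite ext_Eal ext_alE.
- exact: ext_al0.
- by move=> i; rewrite ext_Ebe ext_beE.
- exact: ext_be0.
- rewrite -[al * al]mul1r -ext_sum1 mulr_suml big1 // => i _.
  have a_E : a_ i = a_ i * E i.+1 by rewrite ext_aE eqxx.
  by rewrite mulrA ext_Eal a_E -mulrA ext_Eal ext_aa.
- rewrite -[be * be]mul1r -ext_sum1 mulr_suml big1 // => -[[|i] hi] _ /=.
    by rewrite mulrA ext_be0 mul0r.
  have b_E : b_ i = b_ i * E i by rewrite ext_bE eqxx.
  rewrite mulrA ext_Ebe b_E -mulrA; case: (i) => [|j].
    by rewrite ext_be0 mulr0.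
  by rewrite ext_Ebe ext_bb.
- have a_be i : a_ i * be = a_ i * b_ i.
    by rewrite -[in RHS]ext_Ebe mulrA ext_aE eqxx.
  have b_al i : b_ i * al = b_ i * a_ i.
    by rewrite -[in RHS]ext_Eal mulrA ext_bE eqxx.
  (* Both products are cut along the idempotents. At vertex 0 the left part is [a_ 0 * b_ 0 = 0] and
     no arrow [b_] starts there; at vertex [i.+1] the equality is [ext_ba]. *)
  rewrite -[LHS]mul1r -[RHS]mul1r -ext_sum1 [LHS]mulr_suml [RHS]mulr_suml.
  rewrite [RHS]big_ord_recl [LHS]big_ord_recl mulrA ext_Eal a_be ext_ab0.
  rewrite [in RHS]mulrA ext_be0 mul0r.
  congr (_ + _); apply: eq_bigr => i _.
  by rewrite !mulrA /= /bump add1n ext_Eal ext_Ebe a_be b_al ext_ba.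
Qed.

End ZigzagFromRelations.

Section RelationsFromZigzag.
Variables (k : fieldType) (B : algType k) (m : nat).
Variables (E : nat -> B) (al be : B).
Hypothesis zz : zigzag m E al be.

(** The two boundary relations hold because [al * be = be * al] allows the order to be exchanged
    until [E 0 * be] or [E m.+1] appears, and both are 0. *)
Lemma rels_of_zigzag :
  tildeA_rels (fun i : 'I_m.+1 => E i) (fun i : 'I_m => E i * al)
              (fun i : 'I_m => be * E i).
Proof.
case: zz => idem one out Eal al0 beE be0 al2 be2 comm.
have idemE i : E i * E i = E i by rewrite idem eqxx.
rewrite /tildeA_rels; repeat match goal with |- _ /\ _ => split end => //=.
- by move=> i; rewrite /bump /= add1n mulrA idemE -mulrA -Eal mulrA idemE.
- by move=> i; rewrite /bump /= add1n beE mulrA idemE -mulrA beE mulrA idemE.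
- move=> i j ->; split.
    by rewrite Eal -mulrA (mulrA (E _)) idemE Eal mulrA al2 mul0r.
  by rewrite (beE i) -mulrA (mulrA (E _)) idemE -beE mulrA be2 mul0r.
- by move=> i ->; rewrite mulrA -[_ * al * be]mulrA comm !mulrA be0 !mul0r.
- by move=> i im; rewrite mulrA -(mulrA be) idemE beE im -mulrA -comm mulrA Eal
                        out // mulr0 mul0r.
- move=> i j ->; rewrite -(mulrA be) (mulrA (E i)) idemE -(mulrA (E _)).
  rewrite (mulrA al) comm -(mulrA be al) -Eal (mulrA (E i.+1)) -beE -mulrA.
  by rewrite (mulrA (E i)) idemE.
Qed.

End RelationsFromZigzag.

(** * Monomials, their multiplication table and the universal property *)

Section Monomials.
Variables (k : fieldType) (B : algType k) (m : nat).
Variables (E : nat -> B) (al be : B).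
Hypothesis zz : zigzag m E al be.

Definition mon (i : nat) (s t : bool) : B := E i * al ^+ s * be ^+ t.

Lemma zz_alX i (s : nat) : E i * al ^+ s = al ^+ s * E (i + s)%N.
Proof.
elim: s i => [|s IH] i; first by rewrite !expr0 mulr1 mul1r addn0.
by rewrite exprS mulrA (zz_al zz) -mulrA IH mulrA addSnnS.
Qed.

Lemma zz_beX i (s : nat) : be ^+ s * E i = E (i + s)%N * be ^+ s.
Proof.
elim: s i => [|s IH] i; first by rewrite !expr0 mulr1 mul1r addn0.
by rewrite exprSr -mulrA (zz_be zz) mulrA IH -mulrA addSnnS.
Qed.

Lemma zz_comm_alX s : GRing.comm (al ^+ s) be.
Proof. by apply/commr_sym/commrX/esym/(zz_comm zz). Qed.

Lemma mulr_bool_expr (x : B) (s t : bool) : x * x = 0 ->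
  x ^+ s * x ^+ t = if s && t then 0 else x ^+ (s || t).
Proof. by case: s t => [] [] xx; rewrite ?expr0 ?expr1 ?mulr1 ?mul1r. Qed.

(** The condition [i + s == j + t] says that the first path ends, at [i + s - t], where the second
    one starts. The structure constants depend only on the indices, hence are the same in every
    algebra satisfying the relations. *)
Lemma mon_mul i s t j s' t' :
  mon i s t * mon j s' t' =
  if [&& i + s == j + t, ~~ (s && s') & ~~ (t && t')]%N
  then mon i (s || s') (t || t') else 0.
Proof.
rewrite /mon !mulrA -[_ * be ^+ t * E j]mulrA zz_beX (zz_alX i) !mulrA.
rewrite -[al ^+ s * _ * _]mulrA (zz_idem zz).
case: eqP => [ij|_] /=; last by rewrite mulr0 !mul0r.
rewrite -zz_alX -[_ * be ^+ t * _]mulrA -(commrX t (zz_comm_alX s')) !mulrA.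
rewrite -[_ * al ^+ s * _]mulrA -[X in X = _]mulrA.
rewrite (mulr_bool_expr _ _ (zz_al2 zz)) (mulr_bool_expr _ _ (zz_be2 zz)).
by case: ifP => _; case: ifP => _ /=; rewrite ?mulr0 ?mul0r.
Qed.

Lemma mon_invalid i s t : (m <= i)%N && s || (i == 0%N) && t -> mon i s t = 0.
Proof.
rewrite /mon; case/orP=> /andP [hi ->].
  by rewrite expr1 (zz_al zz) (zz_out zz) ?mulr0 ?mul0r.
by rewrite (eqP hi) expr1 -mulrA (zz_comm_alX s) mulrA (zz_be0 zz) mul0r.
Qed.

Lemma mon_one : \sum_(i < m.+1) mon i false false = 1.
Proof.
by rewrite -(zz_one zz); apply: eq_bigr => i _; rewrite /mon !expr0 !mulr1.
Qed.

Lemma mon_a i : mon i true false = E i * al.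
Proof. by rewrite /mon expr0 expr1 mulr1. Qed.

Lemma mon_b i : mon i.+1 false true = be * E i.
Proof. by rewrite /mon expr0 expr1 mulr1 (zz_be zz). Qed.

Lemma sum_aE : \sum_(i < m) E i * al = al.
Proof.
rewrite -[RHS]mul1r -(zz_one zz) mulr_suml big_ord_recr /=.
by rewrite (zz_al zz m) (zz_out zz) // mulr0 addr0.
Qed.

Lemma sum_bE : \sum_(i < m) be * E i = be.
Proof.
rewrite -[RHS]mulr1 -(zz_one zz) mulr_sumr big_ord_recr /=.
by rewrite (zz_be zz m) (zz_out zz) // mul0r addr0.
Qed.

End Monomials.

(** For [i <= m] and [m > 0] these are [4 * m] triples; by [mon_invalid] all other monomials
    vanish. *)
Definition valid (m i : nat) (s t : bool) :=
  (s ==> (i < m)%N) && (t ==> (0 < i)%N).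

(** The valid monomials form a basis, with [c] as coordinate functions. The sum may run over all
    triples because the invalid monomials are 0. *)
Definition mon_basis (k : fieldType) (A : algType k) (m : nat)
    (E : nat -> A) (al be : A) (c : 'I_m.+1 * bool * bool -> A -> k) : Prop :=
  [/\ forall J (z : k) x y, c J (z *: x + y) = z * c J x + c J y,
      forall x, x = \sum_J c J x *: mon E al be J.1.1 J.1.2 J.2
    & forall J K : 'I_m.+1 * bool * bool, valid m K.1.1 K.1.2 K.2 ->
        c J (mon E al be K.1.1 K.1.2 K.2) = (J == K)%:R].

Section Presentation.
Variables (k : fieldType) (A : algType k) (m : nat).
Variables (E : nat -> A) (al be : A) (c : 'I_m.+1 * bool * bool -> A -> k).
Hypotheses (zz : zigzag m E al be) (cP : mon_basis E al be c).

(** The homomorphism sends each basis monomial to the same monomial in [B]; it is multiplicative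
    because [mon_mul] gives both sides the same structure constants. It is unique because [al] and
    [be] are sums of arrows. *)
Lemma zigzag_presents :
  presents_tildeA (fun i : 'I_m.+1 => E i) (fun i : 'I_m => E i * al)
                  (fun i : 'I_m => be * E i).
Proof.
split=> [|B e' a' b' rels']; first exact: rels_of_zigzag.
have zz' := zigzag_of_rels rels'.
set E' := ext e' in zz'; set al' := \sum_(i < m) ext a' i in zz'.
set be' := \sum_(i < m) ext b' i in zz'.
case: cP => c_lin c_span c_dual.
pose M (J : 'I_m.+1 * bool * bool) := mon E al be J.1.1 J.1.2 J.2.
pose M' (J : 'I_m.+1 * bool * bool) := mon E' al' be' J.1.1 J.1.2 J.2.
pose f x := \sum_J c J x *: M' J.
have f_lin (z : k) x y : f (z *: x + y) = z *: f x + f y.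
  rewrite /f scaler_sumr -big_split /=; apply: eq_bigr => J _.
  by rewrite c_lin scalerDl scalerA.
have f0 : f 0 = 0.
  have := f_lin 1 0 0; rewrite !scale1r addr0 => /eqP.
  by rewrite -subr_eq subrr => /eqP.
have fZ (z : k) x : f (z *: x) = z *: f x.
  by rewrite -[z *: x]addr0 f_lin f0 addr0.
have fD x y : f (x + y) = f x + f y by rewrite -[x]scale1r f_lin !scale1r.
have f_sum (I : finType) (F : I -> A) : f (\sum_i F i) = \sum_i f (F i).
  exact: (big_morph f fD f0).
(* Invalid triples have to be included, since they arise in products; there both monomials are 0. *)
have f_mon i s t : (i < m.+1)%N -> f (mon E al be i s t) = mon E' al' be' i s t.
  move=> hi; have [v|] := boolP (valid m i s t).
    rewrite /f (bigD1 (Ordinal hi, s, t)) //= big1 => [|J nJ].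
      by rewrite (c_dual _ (Ordinal hi, s, t)) // eqxx scale1r addr0.
    by rewrite (c_dual _ (Ordinal hi, s, t)) // (negPf nJ) scale0r.
  rewrite negb_and !negb_imply -!leqNgt leqn0 => v.
  rewrite (mon_invalid zz) 1?(mon_invalid zz') ?f0 //.
    by rewrite andbC [_ && t]andbC.
  by rewrite andbC [_ && t]andbC.
have f_M J : f (M J) = M' J by apply: f_mon.
have f1 : f 1 = 1.
  rewrite -(mon_one zz) -(mon_one zz') f_sum.
  by apply: eq_bigr => i _; rewrite f_mon.
have fM x y : f (x * y) = f x * f y.
  rewrite [x in LHS]c_span [y in LHS]c_span big_distrlr f_sum /=.
  rewrite {2 3}/f big_distrlr /=.
  apply: eq_bigr => J _; rewrite f_sum; apply: eq_bigr => K _.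
  rewrite -!scalerAl -!scalerAr !fZ; do 2 congr (_ *: _).
  by rewrite /M' (mon_mul zz) (mon_mul zz'); case: ifP => // _; rewrite f_mon.
exists f; split.
- by split.
- move=> i /=; have := @f_mon i false false (ltn_ord i).
  by rewrite /mon !expr0 !mulr1 /E' ext_ord.
- move=> i /=; rewrite -(mon_a E al be) f_mon; last by rewrite ltnS ltnW.
  by rewrite mon_a /E' /al' (ext_Eal rels') ext_ord.
- move=> i /=; rewrite -(mon_b zz) f_mon; last by rewrite ltnS.
  by rewrite (mon_b zz') /E' /be' (ext_beE rels') ext_ord.
move=> g [g_lin g1 gM] ge ga gb.
have g0 : g 0 = 0.
  have := g_lin 1 0 0; rewrite !scale1r addr0 => /eqP.
  by rewrite -subr_eq subrr => /eqP.
have gZ (z : k) x : g (z *: x) = z *: g x.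
  by rewrite -[z *: x]addr0 g_lin g0 addr0.
have gD x y : g (x + y) = g x + g y by rewrite -[x]scale1r g_lin !scale1r.
have g_sum (I : finType) (F : I -> A) : g (\sum_i F i) = \sum_i g (F i).
  exact: (big_morph g gD g0).
have g_al : g al = al'.
  rewrite -(sum_aE zz) g_sum; apply: eq_bigr => i _.
  by have /= -> := ga i; rewrite ext_ord.
have g_be : g be = be'.
  rewrite -(sum_bE zz) g_sum; apply: eq_bigr => i _.
  by have /= -> := gb i; rewrite ext_ord.
move=> x; rewrite [x in LHS]c_span g_sum; apply: eq_bigr => -[[i s] t] _.
rewrite gZ /M' /mon /= !gM; have /= -> := ge i; rewrite /E' ext_ord.
by congr (_ *: (_ * _ * _)); [case: s | case: t]; rewrite ?expr0 ?expr1.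
Qed.

End Presentation.

(** * Finite representation type *)

Section Frames.
Variables (k : fieldType) (A : algType k) (n : nat) (rho : A -> 'M[k]_n).
Hypothesis rho_mod : is_module rho.

Lemma module_scale (z : k) x : rho (z *: x) = z *: rho x.
Proof.
have [lin _ _] := rho_mod.
have rho0 : rho 0 = 0.
  have /eqP := lin 1 0 0; rewrite !scale1r addr0.
  by rewrite -subr_eq subrr => /eqP.
by rewrite -[z *: x]addr0 lin rho0 addr0.
Qed.

Lemma module_add x y : rho (x + y) = rho x + rho y.
Proof. by have [lin _ _] := rho_mod; rewrite -[x]scale1r lin !scale1r. Qed.

Lemma module0 : rho 0 = 0.
Proof. by rewrite -(scale0r 0) module_scale scale0r. Qed.

Lemma module_sum (I : finType) (F : I -> A) :
  rho (\sum_i F i) = \sum_i rho (F i).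
Proof. exact: (big_morph rho module_add module0). Qed.

(** Otherwise the images of [P] and [1%:M - P] would be two nonzero complementary submodules. *)
Lemma indecomposable_idempotent (P : 'M[k]_n) : indecomposable rho ->
  P *m P = P -> (forall a, rho a *m P = P *m rho a) -> P != 0 -> P = 1%:M.
Proof.
move=> [_ ind] PP Pc P0; apply/eqP; rewrite eq_sym -subr_eq0.
apply/negPn/negP => Q0; apply: ind; exists P, (1%:M - P); split.
- by move=> a; rewrite -Pc submxMl.
- by move=> a; rewrite mulmxBl mul1mx -Pc -{1}[rho a]mulmx1 -mulmxBr submxMl.
- by rewrite !lt0n !mxrank_eq0.
- by rewrite -{1}(addrNK P 1%:M) addrC addmx_sub_adds.
apply/row_subP => i.
have : (row i (P :&: (1%:M - P)) <= P :&: (1%:M - P))%MS by exact: row_sub.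
rewrite sub_capmx => /andP [/submxP [D ->] /submxP [D' e]].
by rewrite -PP mulmxA e -mulmxA mulmxBl mul1mx PP subrr mulmx0 sub0mx.
Qed.

Variables (r : nat) (v : nat -> 'rV[k]_n) (phi : nat -> 'cV[k]_n).

Definition dual_frame : Prop :=
  (0 < r)%N /\ forall y z, (y < r)%N -> (z < r)%N ->
    v y *m phi z = ((y == z)%:R)%:M.

(** The condition is imposed on the vectors and on the functionals: the first makes the span of the
    [v y] invariant under [g], the second does the same for the common kernel of the [phi y], its
    complement. *)
Definition frame_stable (g : 'M[k]_n) : Prop :=
  (forall y, (y < r)%N ->
     v y *m g = 0 \/ exists2 z, (z < r)%N & v y *m g = v z) /\
  (forall y, (y < r)%N ->
     g *m phi y = 0 \/ exists2 z, (z < r)%N & g *m phi y = phi z).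

Lemma frame_stable1 : frame_stable 1%:M.
Proof. by split=> y hy; right; exists y; rewrite ?mulmx1 ?mul1mx. Qed.

Lemma frame_stableM g h :
  frame_stable g -> frame_stable h -> frame_stable (g *m h).
Proof.
move=> [gv gp] [hv hp]; split=> y hy.
- rewrite mulmxA; have [->|[z hz ->]] := gv y hy; last exact: hv.
  by left; rewrite mul0mx.
- rewrite -mulmxA; have [->|[z hz ->]] := hp y hy; last exact: gp.
  by left; rewrite mulmx0.
Qed.

Hypothesis fr : dual_frame.

Definition frame_rows : 'M[k]_(r, n) := \matrix_(y < r) v y.
Definition frame_cols : 'M[k]_(n, r) := \matrix_(i < n, z < r) phi z i 0.
Local Notation V := frame_rows.
Local Notation Phi := frame_cols.

Lemma row_frame_rows (y : 'I_r) : row y V = v y.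
Proof. by rewrite rowK. Qed.

Lemma col_frame_cols (z : 'I_r) : col z Phi = phi z.
Proof. by apply/matrixP=> i j; rewrite !mxE ord1. Qed.

Lemma frame_entry (g : 'M[k]_n) (y z : 'I_r) :
  (V *m g *m Phi) y z = (v y *m g *m phi z) 0 0.
Proof.
rewrite !mxE; apply: eq_bigr => j _; rewrite !mxE; congr (_ * _).
by apply: eq_bigr => l _; rewrite mxE.
Qed.

Lemma frame_dual : V *m Phi = 1%:M.
Proof.
apply/matrixP => y z; rewrite -[V]mulmx1 frame_entry mulmx1 (proj2 fr) //.
by rewrite !mxE.
Qed.

Lemma frame_stable_rows g : frame_stable g -> V *m g *m (Phi *m V) = V *m g.
Proof.
move=> [gv _]; apply/row_matrixP => y.
rewrite row_mul row_mul row_frame_rows.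
have [->|[z hz ->]] := gv y (ltn_ord y); first by rewrite mul0mx.
by rewrite -(row_frame_rows (Ordinal hz)) -row_mul mulmxA frame_dual mul1mx.
Qed.

Lemma frame_stable_cols g : frame_stable g -> Phi *m V *m (g *m Phi) = g *m Phi.
Proof.
move=> [_ gp]; apply/trmx_inj/row_matrixP => y; rewrite -!tr_col; congr _^T.
have colM l p q (X : 'M[k]_(l, p)) (Y : 'M_(p, q)) i :
  col i (X *m Y) = X *m col i Y by rewrite !colE mulmxA.
rewrite !colM col_frame_cols.
have [->|[z hz ->]] := gp y (ltn_ord y); first by rewrite mulmx0.
by rewrite -(col_frame_cols (Ordinal hz)) -colM -mulmxA frame_dual mulmx1.
Qed.

(** Both sides equal [Phi *m V *m g *m Phi *m V], by stability of the columns and of the rows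
    respectively. *)
Lemma frame_stable_comm g : frame_stable g -> g *m (Phi *m V) = Phi *m V *m g.
Proof.
move=> gs; rewrite -[in RHS]mulmxA -(frame_stable_rows gs) !mulmxA.
by rewrite -[X in X *m V](frame_stable_cols gs) !mulmxA.
Qed.

(** The idempotent [Phi *m V] is nonzero because [V *m Phi] is an identity matrix of positive size.
    Hence it is the identity, and the frame is a basis of the whole module. *)
Lemma frame_iso : indecomposable rho ->
  (forall a, rho a *m (Phi *m V) = Phi *m V *m rho a) ->
  module_iso rho (fun a => V *m rho a *m Phi).
Proof.
move=> ind comm; exists Phi, V.
have PV1 : Phi *m V = 1%:M.
  apply: indecomposable_idempotent => //.
    by rewrite mulmxA -(mulmxA Phi) frame_dual mulmx1.
  apply/eqP => P0; have := frame_dual.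
  rewrite -[V *m _]mulmx1 -{1}frame_dual !mulmxA -(mulmxA V) P0 mulmx0 mul0mx.
  case: fr => r0 _ /matrixP /(_ (Ordinal r0) (Ordinal r0)) /eqP.
  by rewrite !mxE eqxx eq_sym oner_eq0.
split=> //; first exact: frame_dual.
by move=> a; rewrite !mulmxA PV1 mul1mx.
Qed.

End Frames.


Section FiniteType.
Variables (k : fieldType) (A : algType k) (m D : nat).
Variables (E : nat -> A) (al be : A) (c : 'I_m.+1 * bool * bool -> A -> k).
Hypotheses (zz : zigzag m E al be) (cP : mon_basis E al be c).

Definition framed n (rho : A -> 'M[k]_n) : Prop :=
  exists r v phi, [/\ (r <= D)%N, dual_frame r v phi,
    forall i, frame_stable r v phi (rho (E i)), frame_stable r v phi (rho al)
    & frame_stable r v phi (rho be)].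

(** A dimension at most [D] together with a 0/1 matrix for each monomial, padded to a fixed size so
    that the tables form a finite type. The list of representatives is indexed by all tables, also
    by those that describe no module. *)
Definition table := ({ffun 'I_m.+1 * bool * bool * 'I_D.+1 * 'I_D.+1 -> bool}
                     * 'I_D.+1)%type.

Definition table_dim (t : table) : nat := t.2.

Definition table_mod (t : table) (a : A) : 'M[k]_(table_dim t) :=
  \matrix_(y < table_dim t, z < table_dim t)
    \sum_J c J a * (t.1 (J, inord y, inord z))%:R.

Lemma framed_iso n (rho : A -> 'M[k]_n) :
  is_module rho -> indecomposable rho -> framed rho ->
  exists t, module_iso rho (table_mod t).
Proof.
move=> rmod ind [r [v [phi [rD fr stE stal stbe]]]].
pose M (J : 'I_m.+1 * bool * bool) := mon E al be J.1.1 J.1.2 J.2.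
have [c_lin c_span c_dual] := cP.
have [rho_lin rho1 rhoM] := rmod.
have rhoX (g : A) (s : bool) : frame_stable r v phi (rho g) ->
    frame_stable r v phi (rho (g ^+ s)).
  by case: s; rewrite ?expr1 ?expr0 // rho1 => _; exact: frame_stable1.
have stM J : frame_stable r v phi (rho (M J)).
  by rewrite !rhoM; apply: frame_stableM; [|apply: frame_stableM];
     rewrite ?rhoM; try exact: stE; apply: rhoX.
have rhoE a : rho a = \sum_J c J a *: rho (M J).
  rewrite [a in LHS]c_span (module_sum rmod).
  by apply: eq_bigr => J _; rewrite (module_scale rmod).
have comm a : rho a *m (frame_cols r phi *m frame_rows r v) =
              frame_cols r phi *m frame_rows r v *m rho a.
  rewrite rhoE mulmx_suml mulmx_sumr; apply: eq_bigr => J _.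
  by rewrite -scalemxAl -scalemxAr (frame_stable_comm fr (stM J)).
have rD1 : (r < D.+1)%N by [].
pose t : table := ([ffun q : 'I_m.+1 * bool * bool * 'I_D.+1 * 'I_D.+1 =>
    (v q.1.2 *m rho (M q.1.1) *m phi q.2) 0 0 == 1], Ordinal rD1).
exists t; have [X [Y [XY YX iso]]] := frame_iso fr ind comm.
exists X, Y; split=> // a; rewrite iso; congr (_ *m _).
apply/matrixP => y z.
rewrite (rhoE a) mulmx_sumr mulmx_suml summxE [RHS]mxE.
apply: eq_bigr => J _; rewrite -scalemxAr -scalemxAl mxE; congr (_ * _).
have yr : (y < r)%N := ltn_ord y; have zr : (z < r)%N := ltn_ord z.
rewrite frame_entry ffunE /= !inordK ?(leq_trans yr) ?(leq_trans zr) 1?ltnW //.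
(* A monomial sends [v y] to 0 or to a vector of the frame, so the entry is 0 or 1 and recording
   whether it equals 1 loses nothing. *)
have [+ _] := stM J => /(_ y yr) [->|[w wr ->]].
  by rewrite mul0mx mxE eq_sym oner_eq0.
rewrite (proj2 fr) // !mxE mulr1n.
by case: (w == z); rewrite ?eqxx // eq_sym oner_eq0.
Qed.

Lemma framed_finite_rep_type :
  (forall n (rho : A -> 'M[k]_n), is_module rho -> indecomposable rho ->
     framed rho) -> finite_rep_type A.
Proof.
move=> all_framed; exists #|{: table}|, (fun i => table_dim (enum_val i)).
exists (fun i => table_mod (enum_val i)) => n rho rmod ind.
have [t iso] := framed_iso rmod ind (all_framed n rho rmod ind).
by exists (enum_rank t); rewrite enum_rankK.
Qed.

End FiniteType.

(** * Graded modules: splitting off free summands and strings *)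

Lemma functional_outside (k : fieldType) n (B : 'M[k]_n) (v : 'rV[k]_n) :
  ~~ (v <= B)%MS -> exists2 f : 'cV[k]_n, B *m f = 0 & v *m f = 1%:M.
Proof.
rewrite submxE; move: (cokermx B) (mulmx_coker B) => C BC /rV0Pn [j vj].
exists (((v *m C) 0 j)^-1 *: col j C).
  by rewrite -scalemxAr colE mulmxA BC mul0mx scaler0.
rewrite -scalemxAr colE mulmxA -colE; apply/matrixP => a b.
by rewrite !ord1 mxE [X in _ * X]mxE [RHS]mxE mulVf.
Qed.

Lemma colspan_of_ker (k : fieldType) n (K : 'M[k]_n) (f : 'cV[k]_n) :
  kermx K *m f = 0 -> exists g, f = K *m g.
Proof.
move=> kf; exists (pinvmx K *m f).
have : (1%:M - K *m pinvmx K <= kermx K)%MS.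
  by apply/sub_kermxP; rewrite mulmxBl mul1mx mulmxKpV ?subrr.
case/submxP => D eD; apply/eqP.
by rewrite mulmxA -subr_eq0 -{1}[f]mul1mx -mulmxBl eD -mulmxA kf mulmx0.
Qed.

Section GradedModules.
Variables (k : fieldType) (m n : nat).
Variables (P : nat -> 'M[k]_n) (al be : 'M[k]_n).

(** The zigzag relations with all products reversed, since modules act on row vectors by right
    multiplication. On row vectors [al] lowers the degree and [be] raises it; on functionals, acting
    from the left, the directions are interchanged. *)
Record graded_module : Prop := GradedModule {
  gm_idem : forall i j, P i *m P j = if i == j then P i else 0;
  gm_one : \sum_(i < m.+1) P i = 1%:M;
  gm_out : forall i, (m < i)%N -> P i = 0;
  gm_al : forall i, al *m P i = P i.+1 *m al;
  gm_al0 : P 0%N *m al = 0;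
  gm_be : forall i, P i *m be = be *m P i.+1;
  gm_be0 : be *m P 0%N = 0;
  gm_al2 : al *m al = 0;
  gm_be2 : be *m be = 0;
  gm_comm : be *m al = al *m be }.

Hypothesis gm : graded_module.

Let PP i : P i *m P i = P i.
Proof. by rewrite (gm_idem gm) eqxx. Qed.

Let mulPP l (u : 'M_(l, n)) i : u *m P i *m P i = u *m P i.
Proof. by rewrite -mulmxA PP. Qed.

(** The frame consists of [v], [v al], [v be], [v al be] for a homogeneous [v] not killed by
    [al be]. The dual functionals are obtained from a single [phi] by the complementary
    monomials. *)
Lemma free_frame : al *m be != 0 -> exists v phi,
  [/\ dual_frame 4 v phi, forall i, frame_stable 4 v phi (P i),
      frame_stable 4 v phi al & frame_stable 4 v phi be].
Proof.
move=> ab0.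
have ala l (u : 'M_(l, n)) : u *m al *m al = 0.
  by rewrite -mulmxA (gm_al2 gm) mulmx0.
have beb l (u : 'M_(l, n)) : u *m be *m be = 0.
  by rewrite -mulmxA (gm_be2 gm) mulmx0.
have bea l (u : 'M_(l, n)) : u *m be *m al = u *m al *m be.
  by rewrite -!mulmxA (gm_comm gm).
have abP i : al *m be *m P i = P i *m al *m be.
  case: i => [|i].
    by rewrite -mulmxA (gm_be0 gm) (gm_al0 gm) mulmx0 mul0mx.
  by rewrite -mulmxA -(gm_be gm) mulmxA (gm_al gm).
have [x Px] : exists x, P x *m al *m be != 0.
  case: (pickP (fun x : 'I_m.+1 => P x *m al *m be != 0)) => [x Px|nP].
    by exists x.
  case/eqP: ab0; rewrite -[al]mul1mx -(gm_one gm) !mulmx_suml big1 // => i _.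
  by apply/eqP/negbFE/nP.
have /rowV0Pn [v1 /submxP [v2 ->] v20] := Px.
pose v := v2 *m P x.
have vab0 : v *m al *m be != 0 by rewrite /v -!mulmxA [P x *m _]mulmxA.
have [f _ vf] : exists2 f : 'cV_n,
    (0 : 'M_n) *m f = 0 & v *m al *m be *m f = 1%:M.
  by apply: functional_outside; rewrite submx0.
have vP i : v *m P i = if i == x then v else 0.
  by rewrite /v -mulmxA (gm_idem gm) eq_sym; case: eqP; rewrite ?mulmx0.
pose w := P x *m f.
have Pw i : P i *m w = if i == x then w else 0.
  by rewrite /w mulmxA (gm_idem gm); case: eqP => [->|_]; rewrite ?mul0mx.
have vw : v *m al *m be *m w = 1%:M.
  by rewrite -vf /w !mulmxA -2!(mulmxA v) abP !mulmxA vP eqxx.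
clearbody w; clearbody v.
(* This correction gives [v *m phi = 0] and keeps [v *m al *m be *m phi = 1], because [al *m be]
   preserves the degree and squares to 0. *)
pose c := (v *m w) 0 0; pose phi := w - c *: (al *m be *m w).
have Pphi i : P i *m phi = if i == x then phi else 0.
  rewrite /phi mulmxBr -scalemxAr !mulmxA -abP -(mulmxA (al *m be)) Pw.
  by case: eqP => // _; rewrite mulmx0 scaler0 subrr.
have abphi : v *m al *m be *m phi = 1%:M.
  by rewrite /phi mulmxBr -scalemxAr !mulmxA bea ala mul0mx !mul0mx scaler0 subr0.
have vphi : v *m phi = 0.
  rewrite /phi mulmxBr -scalemxAr !mulmxA vw scale_scalar_mx mulr1 /c.
  by rewrite -mx11_scalar subrr.
clearbody phi.
(* The two remaining pairings vanish because [v al] and [v be] do not have the degree [x] of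
   [phi]. *)
have vaphi : v *m al *m phi = 0.
  have -> : phi = P x *m phi by rewrite Pphi eqxx.
  by rewrite !mulmxA -(mulmxA v) (gm_al gm) !mulmxA vP
             gtn_eqF ?mul0mx.
have vbphi : v *m be *m phi = 0.
  have -> : v = v *m P x by rewrite vP eqxx.
  by rewrite -(mulmxA v) (gm_be gm) -!mulmxA Pphi gtn_eqF ?mulmx0.
pose vs := nth 0 [:: v; v *m al; v *m be; v *m al *m be].
pose phis := nth 0 [:: al *m be *m phi; be *m phi; al *m phi; phi].
exists vs, phis; split.
- split=> // -[|[|[|[|//]]]] [|[|[|[|//]]]] _ _; rewrite /vs /phis /=;
    do ?[rewrite ?mulmxA ?ala ?beb ?bea ?mul0mx];
    by rewrite ?abphi ?vaphi ?vbphi ?vphi ?mulr0n ?raddf0.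
- move=> i; split=> y; case: y => [|[|[|[|//]]]] _.
  + rewrite /vs /= vP; case: eqP => _; [right; exists 0%N | left] => //.
  + rewrite /vs /= -mulmxA (gm_al gm) mulmxA vP.
    by case: eqP => _; rewrite ?mul0mx; [right; exists 1%N | left].
  + rewrite /vs /=; case: i => [|i].
      by rewrite -mulmxA (gm_be0 gm) mulmx0; left.
    rewrite -mulmxA -(gm_be gm) mulmxA vP.
    by case: eqP => _; rewrite ?mul0mx; [right; exists 2%N | left].
  + rewrite /vs /= -2!mulmxA (mulmxA al) abP !mulmxA vP.
    by case: eqP => _; rewrite ?mul0mx; [right; exists 3%N | left].
  + rewrite /phis /= !mulmxA -abP -mulmxA Pphi.
    by case: eqP => _; rewrite ?mulmx0; [right; exists 0%N | left].
  + rewrite /phis /= mulmxA (gm_be gm) -mulmxA Pphi.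
    by case: eqP => _; rewrite ?mulmx0; [right; exists 1%N | left].
  + rewrite /phis /= mulmxA; case: i => [|i].
      by rewrite (gm_al0 gm) mul0mx; left.
    rewrite -(gm_al gm) -mulmxA Pphi.
    by case: eqP => _; rewrite ?mulmx0; [right; exists 2%N | left].
  + by rewrite /phis /= Pphi; case: eqP => _; [right; exists 3%N | left].
- split=> y; case: y => [|[|[|[|//]]]] _; rewrite /vs /phis /=.
  + by right; exists 1%N.
  + by left; rewrite ala.
  + by right; exists 3%N; rewrite // bea.
  + by left; rewrite bea ala mul0mx.
  + by left; rewrite !mulmxA (gm_al2 gm) !mul0mx.
  + by right; exists 0%N; rewrite // mulmxA.
  + by left; rewrite !mulmxA (gm_al2 gm) !mul0mx.
  + by right; exists 2%N.
- split=> y; case: y => [|[|[|[|//]]]] _; rewrite /vs /phis /=.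
  + by right; exists 2%N.
  + by right; exists 3%N.
  + by left; rewrite beb.
  + by left; rewrite beb.
  + by left; rewrite !mulmxA (gm_comm gm) -(mulmxA al) (gm_be2 gm) mulmx0 !mul0mx.
  + by left; rewrite !mulmxA (gm_be2 gm) !mul0mx.
  + by right; exists 0%N; rewrite // mulmxA (gm_comm gm).
  + by right; exists 1%N.
Qed.

Definition shift_in T (a : T) (f : nat -> T) (y : nat) : T :=
  if y is y'.+1 then f y' else a.

(* Zigzag strings: [v y] has degree [x + y], and the vertices of a string are
   alternately sources (both operators may be nonzero) and sinks; [src] says
   whether [v 0] is a source.  The [phi y] form a dual string of functionals. *)
Definition is_string (src : bool) (x r : nat)
    (v : nat -> 'rV[k]_n) (phi : nat -> 'cV[k]_n) : Prop :=
  [/\ forall y, (r <= y)%N -> v y = 0 /\ phi y = 0,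
      forall y, v y *m P (x + y) = v y /\ P (x + y) *m phi y = phi y,
      forall y, (y < r)%N -> v y *m phi y = 1%:M
    & forall y, if src (+) odd y then
        [/\ v y *m be = v y.+1, al *m phi y = 0, be *m phi y = 0
          & (y.+1 < r)%N -> be *m phi y.+1 = phi y]
      else
        [/\ v y *m al = 0, v y *m be = 0, al *m phi y = phi y.+1
          & (y.+1 < r)%N -> v y.+1 *m al = v y]].

Lemma string_nil src x : is_string src x 0 (fun _ => 0) (fun _ => 0).
Proof.
by split=> // y; last case: ifP => _; split=> //; rewrite ?mul0mx ?mulmx0.
Qed.

Lemma string_cons src x r v phi v0 phi0 : is_string (~~ src) x.+1 r v phi ->
    v0 *m P x = v0 -> P x *m phi0 = phi0 -> v0 *m phi0 = 1%:M ->
    (if src then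
        [/\ v0 *m be = v 0%N, al *m phi0 = 0, be *m phi0 = 0
          & (0 < r)%N -> be *m phi 0%N = phi0]
      else
        [/\ v0 *m al = 0, v0 *m be = 0, al *m phi0 = phi 0%N
          & (0 < r)%N -> v 0%N *m al = v0]) ->
  is_string src x r.+1 (shift_in v0 v) (shift_in phi0 phi).
Proof.
move=> [out deg dual edge] v0P Pphi0 vphi0 edge0; split.
- by case=> // y; apply: out.
- by case=> [|y]; rewrite ?addn0 // addnS; apply: deg.
- by case=> // y; apply: dual.
- case=> [|y] /=; first by rewrite addbF; case: src edge0 {edge}.
  by rewrite addbN -addNb; have := edge y; case: ifP.
Qed.

Hypothesis ab0 : al *m be = 0.

Let alaE l (u : 'M_(l, n)) : u *m al *m al = 0.
Proof. by rewrite -mulmxA (gm_al2 gm) mulmx0. Qed.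
Let bebE l (u : 'M_(l, n)) : u *m be *m be = 0.
Proof. by rewrite -mulmxA (gm_be2 gm) mulmx0. Qed.
Let abE l (u : 'M_(l, n)) : u *m al *m be = 0.
Proof. by rewrite -mulmxA ab0 mulmx0. Qed.
Let baE l (u : 'M_(l, n)) : u *m be *m al = 0.
Proof. by rewrite -mulmxA (gm_comm gm) ab0 mulmx0. Qed.

(* A strict inclusion X < Y in degree x is either detected by a vector and a
   functional that end the string at x, or it is carried to a strict inclusion
   in degree x + 1: to the images under [be] at a source, to the preimages
   under [al] at a sink. *)
Lemma string_from_gap N : forall x src (X Y : 'M[k]_n), (m < x + N)%N ->
  (X <= Y)%MS -> ~~ (Y <= X)%MS -> (Y <= P x)%MS ->
  (if src then (al *m P x <= X)%MS /\ (be *m P x <= X)%MS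
   else Y *m al = 0 /\ Y *m be = 0) ->
  exists r v phi, [/\ is_string src x r.+1 v phi, (v 0%N <= Y)%MS
                    & X *m phi 0%N = 0].
Proof.
elim: N => [|N IH] x src X Y.
  rewrite addn0 => xm _ YX YP; case/negP: YX.
  by move: YP; rewrite (gm_out gm) // submx0 => /eqP ->; rewrite sub0mx.
rewrite addnS -addSn => xN XY YX YP edge.
have fixP l (u : 'M_(l, n)) : (u <= Y)%MS -> u *m P x = u.
  by move=> uY; have /submxP [D ->] := submx_trans uY YP; rewrite mulPP.
have XP := fixP _ _ XY; have YPx := fixP _ _ (submx_refl Y).
case: src edge => [[alX beX]|[Yal Ybe]].
(* At a source the string ends if [Y] contains a vector outside [X] that [be] kills. Otherwise the
   kernel of [be] on [Y] lies in [X], which keeps [X be < Y be] strict. *)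
- have [kerX|/row_subPn [i]] := boolP (Y :&: kermx be <= X)%MS; last first.
    set v0 := row i _ => v0X.
    have : (v0 <= Y :&: kermx be)%MS by exact: row_sub.
    rewrite sub_capmx => /andP [v0Y /sub_kermxP v0be].
    have [f Xf v0f] := functional_outside v0X.
    exists 0%N, (shift_in v0 (fun=> 0)), (shift_in (P x *m f) (fun=> 0)).
    split=> //=; last by rewrite mulmxA XP.
    apply: string_cons; first exact: string_nil.
    + exact: fixP.
    + by rewrite mulmxA PP.
    + by rewrite mulmxA fixP.
    split=> //; rewrite mulmxA.
    + by have /submxP [D ->] := alX; rewrite -mulmxA Xf mulmx0.
    + by have /submxP [D ->] := beX; rewrite -mulmxA Xf mulmx0.
  have [] := IH x.+1 false (X *m be) (Y *m be) xN.
  + exact: submxMr.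
  + apply: contra YX => /submxP [D eD].
    have : (Y - D *m X <= X)%MS.
      apply: submx_trans kerX; rewrite sub_capmx; apply/andP; split.
        by rewrite addmx_sub // eqmx_opp mulmx_sub.
      by apply/sub_kermxP; rewrite mulmxBl eD mulmxA subrr.
    by move=> sub; rewrite -(subrK (D *m X) Y) addmx_sub // submxMl.
  + by rewrite -YPx -mulmxA (gm_be gm) mulmxA submxMl.
  + by rewrite baE bebE.
  move=> r [v [phi [str /submxP [D v0E] Xphi]]].
  have [_ deg dual _] := str; have [_] := deg 0%N; rewrite addn0 => Pphi.
  exists r.+1, (shift_in (D *m Y) v), (shift_in (be *m phi 0%N) phi).
  split=> /=; last by rewrite mulmxA.
    apply: string_cons => //.
    + by rewrite fixP // submxMl.
    + by rewrite mulmxA (gm_be gm) -mulmxA Pphi.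
    + by rewrite -(dual 0%N) // v0E !mulmxA.
    split=> //; first by rewrite v0E mulmxA.
      by rewrite mulmxA ab0 mul0mx.
    by rewrite mulmxA (gm_be2 gm) mul0mx.
  exact: submxMl.
(* At a sink the string ends if some vector of [Y] is not reached modulo [X] by [al] from degree
   [x.+1]. Otherwise the preimages of [X] and [Y] under [al] differ. *)
- have [YXP|/row_subPn [i]] := boolP (Y <= X + P x.+1 *m al)%MS; last first.
    set v0 := row i _ => v0X.
    have v0Y : (v0 <= Y)%MS by exact: row_sub.
    have [f Xf v0f] := functional_outside v0X.
    have kills (u : 'M_n) : (u <= X + P x.+1 *m al)%MS -> u *m f = 0.
      by case/submxP => D ->; rewrite -mulmxA Xf mulmx0.
    exists 0%N, (shift_in v0 (fun=> 0)), (shift_in (P x *m f) (fun=> 0)).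
    split=> //=; last by rewrite mulmxA XP kills // addsmxSl.
    apply: string_cons; first exact: string_nil.
    + exact: fixP.
    + by rewrite mulmxA PP.
    + by rewrite mulmxA fixP.
    split=> //.
    + by have /submxP [D ->] := v0Y; rewrite -mulmxA Yal mulmx0.
    + by have /submxP [D ->] := v0Y; rewrite -mulmxA Ybe mulmx0.
    + by rewrite mulmxA (gm_al gm) kills // addsmxSr.
  pose pre (Z : 'M[k]_n) := (kermx (al *m cokermx Z) :&: P x.+1)%MS.
  have preP l (u : 'M_(l, n)) Z :
      (u <= pre Z)%MS = (u *m al <= Z)%MS && (u <= P x.+1)%MS.
    rewrite sub_capmx [(u *m al <= Z)%MS]submxE -mulmxA; congr (_ && _).
    exact/sub_kermxP/eqP.
  have [] := IH x.+1 true (pre X) (pre Y) xN.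
  + have := submx_refl (pre X); rewrite {2}/pre !preP => /andP [preX ->].
    by rewrite (submx_trans preX XY).
  + apply: contra YX => sub; have /sub_addsmxP [u eY] := YXP.
    have : (u.2 *m P x.+1 <= pre X)%MS.
      apply: submx_trans sub; rewrite preP submxMl andbT -mulmxA.
      rewrite -[u.2 *m _](addKr (u.1 *m X)) -eY addmx_sub // eqmx_opp.
      by rewrite mulmx_sub.
    rewrite preP -mulmxA => /andP [sub' _].
    by rewrite eY addmx_sub // submxMl.
  + exact: capmxSr.
  + by split; rewrite preP submxMl andbT -mulmxA -(gm_al gm) mulmxA
       ?(gm_comm gm) ?ab0 ?(gm_al2 gm) mul0mx sub0mx.
  move=> r [v [phi [str v0Y Xphi]]].
  have [_ deg dual _] := str; have [v0P Pphi] := deg 0%N.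
  rewrite addn0 in v0P Pphi.
  pose K := P x.+1 *m al *m cokermx X.
  (* The next functional kills [pre X], which contains [kermx K *m P x.+1], so it factors through
     [K]. The factor [g] yields a functional in degree [x] that kills [X] and is sent by [al] to
     [phi 0]. *)
  have [|g phiE] := @colspan_of_ker _ _ K (phi 0%N).
    have : (kermx K *m P x.+1 <= pre X)%MS.
      rewrite preP submxMl andbT submxE; apply/eqP.
      by have := mulmx_ker K; rewrite {2}/K !mulmxA.
    case/submxP => D eD.
    by rewrite -Pphi mulmxA eD -mulmxA Xphi mulmx0.
  rewrite preP in v0Y; have /andP [v0alY _] := v0Y.
  have alphi : al *m (P x *m cokermx X *m g) = phi 0%N.
    by rewrite phiE /K !mulmxA (gm_al gm).
  exists r.+1, (shift_in (v 0%N *m al) v).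
  exists (shift_in (P x *m cokermx X *m g) phi).
  split=> //=; last by rewrite mulmxA (mulmxA X) XP mulmx_coker mul0mx.
  apply: string_cons; first exact: str.
  + exact: fixP.
  + by rewrite !mulmxA PP.
  + by rewrite -mulmxA alphi dual.
  by split=> //; rewrite ?alaE ?abE.
Qed.

(** The walk starts in the lowest nonzero degree [x], where no operator can lead further down; the
    string therefore needs no extension to the left. *)
Lemma string_frame : (0 < n)%N -> exists r v phi,
  [/\ (r <= m.+1)%N, dual_frame r v phi, forall i, frame_stable r v phi (P i),
      frame_stable r v phi al & frame_stable r v phi be].
Proof.
move=> n0.
have exP : exists x, P x != 0.
  case: (pickP (fun x : 'I_m.+1 => P x != 0)) => [x Px|nP]; first by exists x.
  have /eqP := gm_one gm; rewrite big1 => [|i _]; last exact/eqP/negbFE/nP.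
  by rewrite eq_sym -mxrank_eq0 mxrank1 -leqn0 leqNgt n0.
have [x Px xmin] := ex_minnP exP.
have Plow y : (y < x)%N -> P y = 0.
  by move=> yx; apply/eqP/negPn; apply/negP => /xmin; rewrite leqNgt yx.
have Pal : P x *m al = 0.
  case: (x) Plow => [|y] Plow; first exact: (gm_al0 gm).
  by rewrite -(gm_al gm) Plow ?mulmx0.
have beP : be *m P x = 0.
  case: (x) Plow => [|y] Plow; first exact: (gm_be0 gm).
  by rewrite -(gm_be gm) Plow ?mul0mx.
have [src [r [v [phi str]]]] : exists src r v phi, is_string src x r.+1 v phi.
  (* If [al] does not reach all of degree [x], the gap between its image and [P x] starts a string
     at a source. Otherwise [be] kills degree [x] because [al *m be = 0], and the gap between 0 and
     [P x] starts a string at a sink. *)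
  have [PX|PX] := boolP (P x <= al *m P x)%MS; last first.
    have [|||||r [v [phi [str _ _]]]] :=
        @string_from_gap m.+1 x true (al *m P x) (P x) => //.
    - by rewrite addnS ltnS leq_addl.
    - exact: submxMl.
    - by rewrite beP sub0mx submx_refl.
    by exists true, r, v, phi.
  have [|||||r [v [phi [str _ _]]]] :=
      @string_from_gap m.+1 x false 0 (P x) => //.
  - by rewrite addnS ltnS leq_addl.
  - exact: sub0mx.
  - by rewrite submx0.
  - split=> //; have /submxP [D ->] := PX.
    by rewrite -!mulmxA (gm_be gm) (mulmxA al) ab0 mul0mx mulmx0.
  by exists false, r, v, phi.
have [out deg dual edge] := str.
have out_or l1 l2 (f : nat -> 'M[k]_(l1, l2)) y :
    ((r < y)%N -> f y = 0) -> f y = 0 \/ exists2 z, (z < r.+1)%N & f y = f z.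
  by move=> h; case: (leqP y r) => yr; [right; exists y | left; apply: h].
exists r.+1, v, phi; split.
(* The last vector [v r] is nonzero of degree [x + r], which forces [x + r <= m]. *)
- rewrite ltnS; have [xr|] := leqP (x + r) m.
    by apply: leq_trans xr; apply: leq_addl.
  move=> /(gm_out gm) P0; have [+ _] := deg r; rewrite P0 mulmx0 => v0.
  have := dual r (leqnn _); rewrite -v0 mul0mx => /matrixP /(_ 0 0) /eqP.
  by rewrite !mxE eq_sym oner_eq0.
- split=> // y z yr zr; case: eqP => [<-|/eqP yz]; first exact: dual.
  have [<- _] := deg y; have [_ <-] := deg z.
  rewrite mulmxA -(mulmxA (v y)) (gm_idem gm) eqn_add2l (negPf yz).
  by rewrite mulmx0 mul0mx raddf0.
- move=> i; split=> y yr.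
    have [vP _] := deg y; rewrite -{1 2}vP -mulmxA (gm_idem gm).
    by case: eqP => _; rewrite ?mulmx0 ?vP; [right; exists y | left].
  have [_ Pphi] := deg y; rewrite -{1 2}Pphi mulmxA (gm_idem gm).
  by case: eqP => [->|_]; rewrite ?mul0mx ?Pphi; [right; exists y | left].
- split=> y yr.
    have := edge y; case: ifP => [src_y _|_ [-> _ _ _]]; last by left.
    case: y yr src_y => [_ _|y yr src_y].
      by left; have [<- _] := deg 0%N; rewrite addn0 -mulmxA Pal mulmx0.
    right; exists y; first exact: ltnW.
    by move: src_y (edge y); rewrite /= addbN; case: (_ (+) _) => // _ [_ _ _ ->].
  have := edge y; case: ifP => [_ [_ -> _ _]|_ [_ _ -> _]]; first by left.
  exact: (out_or _ _ phi y.+1 (fun h => proj2 (out _ h))).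
- split=> y yr.
    have := edge y; case: ifP => [_ [-> _ _ _]|_ [_ -> _ _]]; last by left.
    exact: (out_or _ _ v y.+1 (fun h => proj1 (out _ h))).
  have := edge y; case: ifP => [_ [_ _ -> _]|src_y _]; first by left.
  case: y yr src_y => [_ _|y yr src_y].
    by left; have [_ <-] := deg 0%N; rewrite addn0 mulmxA beP mul0mx.
  right; exists y; first exact: ltnW.
  by move: src_y (edge y); rewrite /= addbN; case: (_ (+) _) => // _ [_ _ _ ->].
Qed.

End GradedModules.

Section ZigzagFiniteType.
Variables (k : fieldType) (A : algType k) (m : nat).
Variables (E : nat -> A) (al be : A) (c : 'I_m.+1 * bool * bool -> A -> k).
Hypotheses (zz : zigzag m E al be) (cP : mon_basis E al be c).

Lemma zigzag_finite_rep_type : finite_rep_type A.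
Proof.
(* The bound [m + 4] covers the free frames of size 4 and the strings of size at most [m.+1]. *)
apply: (framed_finite_rep_type (D := m + 4) cP) => n rho rmod ind.
have [rho_lin rho1 rhoM] := rmod; have rho0 := module0 rmod.
have gm : graded_module m (rho \o E) (rho al) (rho be).
  split=> [i j||i mi|i||i||||] /=; rewrite -?rhoM.
  - by rewrite (zz_idem zz) eq_sym; case: eqP => [->|].
  - by rewrite -rho1 -(zz_one zz) (module_sum rmod).
  - by rewrite (zz_out zz).
  - by rewrite (zz_al zz).
  - by rewrite (zz_al0 zz).
  - by rewrite (zz_be zz).
  - by rewrite (zz_be0 zz).
  - by rewrite (zz_al2 zz).
  - by rewrite (zz_be2 zz).
  - by rewrite (zz_comm zz).
have [ab0|ab0] := eqVneq (rho al *m rho be) 0.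
  have [n0 _] := ind.
  have [r [v [phi [rm fr stP stal stbe]]]] := string_frame gm ab0 n0.
  by exists r, v, phi; split=> //; apply: leq_trans rm _; lia.
have [v [phi [fr stP stal stbe]]] := free_frame gm ab0.
by exists 4%N, v, phi; split=> //; lia.
Qed.

End ZigzagFiniteType.

(** * Weight projections, annihilation and creation on the tensor space *)

Section SchurOperators.
Variables (k : fieldType) (d : nat).
Local Notation T := (tensor_basis d).
Local Notation M := 'M[k]_((tdim d).+1).

Definition tinv (u : T) : 'I_(tdim d).+1 :=
  cast_ord (esym (prednK (tensor_card_gt0 d))) (enum_rank u).

Lemma tinvK : cancel tinv (@tidx d).
Proof. by move=> u; rewrite /tidx /tinv cast_ordKV enum_rankK. Qed.

Lemma tidxK : cancel (@tidx d) tinv.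
Proof. by move=> r; rewrite /tidx /tinv enum_valK cast_ordK. Qed.

Definition entry (X : M) (u w : T) : k := X (tinv u) (tinv w).

Lemma entry_ext (X Y : M) : (forall u w, entry X u w = entry Y u w) -> X = Y.
Proof.
by move=> XY; apply/matrixP=> r s; rewrite -[r]tidxK -[s]tidxK; apply: XY.
Qed.

(** The operator that sends the basis tensor [w] to [c w] times [tau w]. All operators below are
    sums of such, so that identities reduce to comparing signs. *)
Definition monomial_mx (c : T -> k) (tau : T -> T) : M :=
  \matrix_(r, s) (if tidx r == tau (tidx s) then c (tidx s) else 0).

Lemma entry_monomial c tau u w :
  entry (monomial_mx c tau) u w = if u == tau w then c w else 0.
Proof. by rewrite /entry mxE !tinvK. Qed.

Lemma eq_monomial c c' tau tau' :
  (forall w, c w = c' w /\ (c w != 0 -> tau w = tau' w)) ->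
  monomial_mx c tau = monomial_mx c' tau'.
Proof.
move=> h; apply/matrixP=> r s; rewrite !mxE.
have [<- ] := h (tidx s).
by have [->|_ ->] := eqVneq (c (tidx s)) 0; rewrite ?if_same.
Qed.

Lemma entryM_monomial (X : M) c tau u w :
  entry (X * monomial_mx c tau) u w = entry X u (tau w) * c w.
Proof.
rewrite /entry -mulmxE mxE (bigD1 (tinv (tau w))) //= big1 => [|j nj].
  by rewrite mxE !tinvK eqxx addr0.
rewrite mxE tinvK; case: eqP => [jw|]; last by rewrite mulr0.
by case/eqP: nj; rewrite -jw tidxK.
Qed.

Lemma monomial_mul c tau c' tau' :
  monomial_mx c tau * monomial_mx c' tau' =
  monomial_mx (fun w => c (tau' w) * c' w) (tau \o tau').
Proof.
apply: entry_ext => u w; rewrite entryM_monomial !entry_monomial.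
by case: eqP => _; rewrite ?mul0r.
Qed.

Lemma entry_monomialM (X : M) c tau u w : involutive tau ->
  entry (monomial_mx c tau * X) u w = c (tau u) * entry X (tau u) w.
Proof.
move=> tauK; rewrite /entry -mulmxE mxE (bigD1 (tinv (tau u))) //= big1 => [|j nj].
  by rewrite mxE !tinvK tauK eqxx addr0.
rewrite mxE tinvK; case: eqP => [jw|]; last by rewrite mul0r.
by case/eqP: nj; rewrite jw tauK tidxK.
Qed.

Lemma monomial_add c c' tau :
  monomial_mx c tau + monomial_mx c' tau = monomial_mx (fun w => c w + c' w) tau.
Proof. by apply/matrixP=> r s; rewrite !mxE; case: ifP; rewrite ?addr0. Qed.

Lemma monomial0 tau : monomial_mx (fun _ => 0) tau = 0.
Proof. by apply/matrixP=> r s; rewrite !mxE if_same. Qed.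

Lemma monomial1 : monomial_mx (fun _ => 1) id = 1.
Proof.
by apply/matrixP=> r s; rewrite !mxE (can_eq tidxK); case: eqP.
Qed.

Definition weight (w : T) : nat := \sum_x w x.

Lemma weight_le w : (weight w <= d)%N.
Proof.
rewrite -[X in (_ <= X)%N]card_ord -sum1_card leq_sum // => x _; exact: leq_b1.
Qed.

Definition weight_proj (i : nat) : M :=
  monomial_mx (fun w => (weight w == i)%:R) id.

Definition flip (x : 'I_d) (w : T) : T := [ffun y => w y (+) (y == x)].

Lemma flipC x y w : flip x (flip y w) = flip y (flip x w).
Proof. by apply/ffunP => z; rewrite !ffunE addbAC. Qed.

Lemma flipK x : involutive (flip x).
Proof. by move=> w; apply/ffunP => z; rewrite !ffunE addbK. Qed.

Lemma flip_inj w : injective (flip^~ w).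
Proof.
by move=> x y /ffunP /(_ x); rewrite !ffunE eqxx => /addbI; case: eqP.
Qed.

Lemma weight_flip x w : (weight (flip x w) + w x = weight w + ~~ w x)%N.
Proof.
rewrite /weight (bigD1 x) //= [in RHS](bigD1 x) //= ffunE eqxx addbT.
rewrite (eq_bigr (fun y => w y : nat)) => [|y ny]; first
  by rewrite -addnA addnC [(_ + w x)%N]addnC.
by rewrite ffunE (negPf ny) addbF.
Qed.

(* The sign exponent of the creation and annihilation operators counts the odd
   tensor factors on the side of [x] given by [R]. *)
Definition odd_before (R : rel 'I_d) (x : 'I_d) (w : T) : bool :=
  \big[addb/false]_(y | R y x) w y.

Lemma odd_before_flip R x z w :
  odd_before R x (flip z w) = odd_before R x w (+) R z x.
Proof.
rewrite /odd_before (eq_bigr (fun y => w y (+) (y == z))) => [|y _]; last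
  by rewrite ffunE.
rewrite big_split /=; congr (_ (+) _); rewrite big_mkcond /= (bigD1 z) //= big1.
  by rewrite eqxx addbF; case: (R z x).
by move=> y /negPf ->; case: ifP.
Qed.

(** The letter [b] is the one found at [x] before the flip: [true] gives annihilation, [false]
    creation. *)
Definition fermi (R : rel 'I_d) (b : bool) (x : 'I_d) : M :=
  monomial_mx (fun w => if w x == b then (-1) ^+ odd_before R x w else 0)
              (flip x).

(** At different places exactly one of the two flips changes the sign of the other operator. At the
    same place the second operator meets the wrong letter. *)
Lemma fermi_anticomm R b x y : (forall z, R z z = false) ->
  (forall z t, z != t -> R z t (+) R t z) ->
  fermi R b x * fermi R b y + fermi R b y * fermi R b x = 0.
Proof.
move=> Rirr Rtot; rewrite !monomial_mul.
have -> c : monomial_mx c (flip y \o flip x) = monomial_mx c (flip x \o flip y).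
  by apply: eq_monomial => w; split=> //= _; exact: flipC.
rewrite monomial_add -(monomial0 (flip x \o flip y)).
apply: eq_monomial => w; split=> //.
rewrite !odd_before_flip !ffunE; have [<-|nxy] := eqVneq x y.
  by rewrite ?eqxx ?addbT; case: (w x) b => [] []; rewrite /= ?mulr0 ?mul0r ?addr0.
rewrite ?addbF.
case: eqP => _; case: eqP => _; rewrite ?mulr0 ?mul0r ?addr0 //.
rewrite !signr_addb; have := Rtot _ _ nxy.
by case: (R x y); case: (R y x) => //= _; rewrite expr0 expr1; ring.
Qed.

Lemma fermi_sum_sqr R b : (2%:R : k) != 0 -> (forall z, R z z = false) ->
  (forall z t, z != t -> R z t (+) R t z) ->
  (\sum_x fermi R b x) * (\sum_x fermi R b x) = 0.
Proof.
move=> two Rirr Rtot; set S := _ * _.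
have : S + S = 0.
  rewrite {1}/S big_distrlr /= /S big_distrlr /= [X in _ + X]exchange_big /=.
  rewrite -big_split big1 //= => x _; rewrite -big_split big1 //= => y _.
  exact: fermi_anticomm.
rewrite -mulr2n -scaler_nat => /eqP; rewrite scaler_eq0 (negPf two) /=.
by move/eqP.
Qed.

Definition before : rel 'I_d := fun y x => (y < x)%N.
Definition after : rel 'I_d := fun y x => (x < y)%N.

(* Signs count the odd factors before [x] for annihilation but after [x] for
   creation; this makes the two sums commute when [d = 0] in [k], whereas the
   usual convention makes them anticommute. *)
Definition annih : M := \sum_x fermi before true x.
Definition creat : M := \sum_x fermi after false x.

Lemma odd_before_after x w :
  odd_before before x w (+) odd_before after x w (+) w x =
  \big[addb/false]_y w y.
Proof.
rewrite [RHS](bigD1 x) //= addbC; congr (_ (+) _).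
rewrite /odd_before [RHS](bigID (fun y : 'I_d => (y < x)%N)) /=.
by congr (_ (+) _); apply: eq_bigl => y; rewrite /before /after -val_eqE /=; lia.
Qed.

(** Operators at different places commute: either both signs change with the order or neither does.
    At one place the commutator is the parity sign of the whole tensor, the same for all [d] places,
    so the sum is [d] times it. *)
Lemma annih_creat_comm : d%:R = 0 :> k -> annih * creat = creat * annih.
Proof.
move=> d0; apply/eqP; rewrite -subr_eq0 [creat * _]big_distrlr exchange_big /=.
rewrite [annih * _]big_distrlr /= -sumrB.
pose par (w : T) := \big[addb/false]_y w y.
rewrite (eq_bigr (fun _ => monomial_mx (fun w => (-1) ^+ par w) id)) => [|x _].
  by rewrite sumr_const card_ord -scaler_nat d0 scale0r.
rewrite -sumrB (bigD1 x) //= [X in _ + X]big1 => [|y nyx].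
  rewrite addr0 !monomial_mul; apply/eqP; rewrite subr_eq.
  have flip2 c : monomial_mx c (flip x \o flip x) = monomial_mx c id.
    by apply: eq_monomial => w; split=> // _; exact: flipK.
  rewrite !flip2 monomial_add; apply/eqP/eq_monomial => w; split=> //.
  rewrite !odd_before_flip !ffunE eqxx !addbT /before /after ltnn !addbF.
  rewrite /par -(odd_before_after x) !signr_addb.
  by case: (w x); rewrite /= ?expr0 ?expr1; ring.
apply/eqP; rewrite subr_eq0; apply/eqP; rewrite !monomial_mul.
apply: eq_monomial => w; split; last by move=> _ /=; rewrite flipC.
rewrite !odd_before_flip !ffunE (eq_sym x y) (negPf nyx) !addbF /before /after.
case: eqP => _; case: eqP => _; rewrite ?mulr0 ?mul0r // !signr_addb; ring.
Qed.

Lemma weight_proj_idem i j :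
  weight_proj i * weight_proj j = if i == j then weight_proj i else 0.
Proof.
rewrite monomial_mul; case: eqP => [->|/eqP ij].
  by apply: eq_monomial => w; case: eqP => _; rewrite ?mulr1 ?mulr0.
rewrite -(monomial0 id); apply: eq_monomial => w; split=> //=.
case: eqP => [->|_]; last by rewrite mul0r.
by rewrite (negPf ij) mulr0.
Qed.

Lemma weight_proj_sum : \sum_(i < d.+1) weight_proj i = 1.
Proof.
rewrite -monomial1; apply/matrixP=> r s; rewrite summxE mxE.
have ws : (weight (tidx s) < d.+1)%N by rewrite ltnS weight_le.
rewrite (bigD1 (Ordinal ws)) //= big1 => [|i ni].
  by rewrite mxE eqxx addr0.
rewrite mxE; case: eqP => _ //; case: eqP => // wi.
by case/eqP: ni; apply: val_inj.
Qed.

Lemma weight_proj_out i : (d < i)%N -> weight_proj i = 0.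
Proof.
move=> di; rewrite -(monomial0 id); apply: eq_monomial => w; split=> //.
by case: eqP => // wi; have := weight_le w; rewrite wi leqNgt di.
Qed.

Lemma schur_zigzag : (2%:R : k) != 0 -> d%:R = 0 :> k ->
  zigzag d weight_proj annih creat.
Proof.
move=> two d0; split.
- exact: weight_proj_idem.
- exact: weight_proj_sum.
- exact: weight_proj_out.
- move=> i; rewrite mulr_sumr mulr_suml; apply: eq_bigr => x _.
  rewrite !monomial_mul; apply: eq_monomial => w; split=> //=.
  case: (w x =P _) => wx; last by rewrite mulr0 mul0r.
  rewrite mulrC; congr (_ * _%:R); have := weight_flip x w; rewrite wx.
  by rewrite /= addn1 addn0 => <-; rewrite eqSS.
- rewrite mulr_suml big1 // => x _; rewrite monomial_mul -(monomial0 (flip x)).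
  apply: eq_monomial => w; split=> //=.
  case: (w x =P _) => wx; last by rewrite mul0r.
  have := weight_flip x w; rewrite wx /= addn1 addn0 => <-.
  by rewrite /= mulr0n mulr0.
- move=> i; rewrite mulr_sumr mulr_suml; apply: eq_bigr => x _.
  rewrite !monomial_mul; apply: eq_monomial => w; split=> //=.
  case: (w x =P _) => wx; last by rewrite mulr0 mul0r.
  rewrite mulrC; congr (_%:R * _); have := weight_flip x w; rewrite wx.
  by rewrite /= addn1 addn0 => ->; rewrite eqSS.
- rewrite mulr_sumr big1 // => x _; rewrite monomial_mul -(monomial0 (flip x)).
  apply: eq_monomial => w; split=> //=.
  case: (w x =P _) => wx; last by rewrite mulr0.
  have := weight_flip x w; rewrite wx /= addn1 addn0 => ->.
  by rewrite /= mulr0n mul0r.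
- apply: fermi_sum_sqr => // [z|z t]; rewrite /before ?ltnn // -val_eqE /=; lia.
- apply: fermi_sum_sqr => // [z|z t]; rewrite /after ?ltnn // -val_eqE /=; lia.
- exact: annih_creat_comm.
Qed.

End SchurOperators.

(** * The commutant of the signed place permutations *)

Section SchurCommutant.
Variables (k : fieldType) (d : nat).
Local Notation T := (tensor_basis d).
Local Notation M := 'M[k]_((tdim d).+1).

Definition swap (i j : 'I_d) (w : T) : T := [ffun x => w (tperm i j x)].

Lemma swapK i j : involutive (swap i j).
Proof. by move=> w; apply/ffunP => x; rewrite !ffunE tpermK. Qed.

Lemma swap_signE i j : swap_sign_mx k i j =
  monomial_mx (fun w => (-1) ^+ (w i && w j)) (swap i j).
Proof. by []. Qed.

Lemma weight_swap i j w : weight (swap i j w) = weight w.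
Proof.
rewrite /weight [RHS](reindex_inj (@perm_inj _ (tperm i j))) /=.
by apply: eq_bigr => x _; rewrite ffunE.
Qed.

Lemma swap_flip i j x w :
  swap i j (flip x w) = flip (tperm i j x) (swap i j w).
Proof.
apply/ffunP => y; rewrite !ffunE; congr (_ (+) _).
by rewrite -(inj_eq (@perm_inj _ (tperm i j))) tpermK.
Qed.

(** The transposition preserves [R] except that it reverses the comparison of [i] with [j]; this is
    where adjacency of the two places enters. *)
Definition adjacent_for (R : rel 'I_d) (i j : 'I_d) := forall y x,
  R (tperm i j y) (tperm i j x) =
  R y x (+) ((x == i) && (y == j) || (x == j) && (y == i)).

(** Sign exponents of flipping at [x] and then swapping, against swapping and then flipping at the
    image of [x]. *)
Lemma odd_before_swap R i j x w : i != j -> adjacent_for R i j ->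
  (flip x w i && flip x w j) (+) odd_before R x w =
  odd_before R (tperm i j x) (swap i j w) (+) (w i && w j).
Proof.
move=> ij adj.
have -> : odd_before R (tperm i j x) (swap i j w) =
    odd_before R x w (+) ((x == i) && w j) (+) ((x == j) && w i).
  rewrite /odd_before big_mkcond (reindex_inj (@perm_inj _ (tperm i j))) /=.
  rewrite [\big[_/_]_(y | R y x) _]big_mkcond /=.
  have sum1 l b : \big[addb/false]_y (if y == l then b && w y else false) = b && w l.
    by rewrite (bigD1 l) //= eqxx big1 ?addbF // => y /negPf ->.
  rewrite -(sum1 j) -(sum1 i) -!big_split /=; apply: eq_bigr => y _.
  rewrite adj ffunE tpermK.
  have : ~~ ((y == i) && (y == j)).
    by apply: contraNN ij => /andP [/eqP <- /eqP <-].
  by case: (R y x); case: (x == i); case: (x == j); case: (y == i);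
     case: (y == j); case: (w y).
rewrite !ffunE (eq_sym i) (eq_sym j).
have [->|_] := eqVneq x i; first
  by rewrite (negPf ij); case: (w i); case: (w j); case: odd_before.
by have [->|_] := eqVneq x j; case: (w i); case: (w j); case: odd_before.
Qed.

Lemma swap_fermi R b i j x : i != j -> adjacent_for R i j ->
  swap_sign_mx k i j * fermi k R b x =
  fermi k R b (tperm i j x) * swap_sign_mx k i j.
Proof.
move=> ij adj; rewrite swap_signE !monomial_mul; apply: eq_monomial => w.
split; last by move=> _ /=; rewrite swap_flip.
rewrite [swap i j w _]ffunE tpermK; case: (w x == b); last by rewrite mulr0 mul0r.
by rewrite -!signr_addb (odd_before_swap x w ij adj).
Qed.

Lemma swap_fermi_sum R b i j : i != j -> adjacent_for R i j ->
  swap_sign_mx k i j * (\sum_x fermi k R b x) =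
  (\sum_x fermi k R b x) * swap_sign_mx k i j.
Proof.
move=> ij adj; rewrite mulr_sumr mulr_suml.
rewrite [RHS](reindex_inj (@perm_inj _ (tperm i j))) /=.
by apply: eq_bigr => x _; rewrite swap_fermi.
Qed.

Lemma adjacent_before (i j : 'I_d) : nat_of_ord j = i.+1 ->
  adjacent_for (@before d) i j.
Proof.
move=> ij y x; rewrite /before; case: tpermP => [->|->|/eqP + /eqP +];
  case: tpermP => [->|->|/eqP + /eqP +]; rewrite -!val_eqE /=; lia.
Qed.

Lemma adjacent_after (i j : 'I_d) : nat_of_ord j = i.+1 ->
  adjacent_for (@after d) i j.
Proof.
move=> ij y x; rewrite /after; case: tpermP => [->|->|/eqP + /eqP +];
  case: tpermP => [->|->|/eqP + /eqP +]; rewrite -!val_eqE /=; lia.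
Qed.

Lemma in_schurP (X : M) :
  reflect (forall i j : 'I_d, nat_of_ord j = i.+1 ->
             X * swap_sign_mx k i j = swap_sign_mx k i j * X)
          (X \in @schur_pred k d).
Proof.
apply: (iffP forallP) => [h i j ij|h i].
  by have /forallP/(_ j)/implyP/(_ (introT eqP ij))/eqP := h i.
by apply/forallP => j; apply/implyP => /eqP ij; apply/eqP/h.
Qed.

Lemma adjacent_neq (i j : 'I_d) : nat_of_ord j = i.+1 -> i != j.
Proof. by move=> ij; rewrite -val_eqE /= ij; lia. Qed.

Lemma annih_in_schur : annih k d \in @schur_pred k d.
Proof.
apply/in_schurP => i j ij; rewrite swap_fermi_sum ?(adjacent_neq ij) //.
exact: adjacent_before.
Qed.

Lemma creat_in_schur : creat k d \in @schur_pred k d.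
Proof.
apply/in_schurP => i j ij; rewrite swap_fermi_sum ?(adjacent_neq ij) //.
exact: adjacent_after.
Qed.

Lemma weight_proj_in_schur i : weight_proj k d i \in @schur_pred k d.
Proof.
apply/in_schurP => a b _; rewrite swap_signE !monomial_mul.
by apply: eq_monomial => w; rewrite /= weight_swap mulrC.
Qed.

Lemma entry_swap (X : M) (i j : 'I_d) u w : X \in @schur_pred k d ->
  nat_of_ord j = i.+1 -> entry X (swap i j u) (swap i j w) =
  (-1) ^+ (u i && u j) * (-1) ^+ (w i && w j) * entry X u w.
Proof.
move=> /in_schurP XS ij.
have := congr1 (fun Y => entry Y (swap i j u) w) (XS i j ij).
rewrite swap_signE entryM_monomial entry_monomialM; last exact: swapK.
rewrite swapK => /(congr1 ( *%R^~ ((-1) ^+ (w i && w j)))) /=.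
have cc : (-1) ^+ (w i && w j) * (-1) ^+ (w i && w j) = 1 :> k.
  by rewrite -signr_addb addbb.
by rewrite -(mulrA (entry X (swap i j u) _)) cc mulr1 => ->; rewrite mulrAC.
Qed.

End SchurCommutant.

(** * Matrix entries as words, up to permutation of the places *)

Section AdjacentSwaps.
Variable L : eqType.

(** The letter wanted first is moved to the front by adjacent swaps; the prefix [p] holds the part
    already in order. *)
Lemma perm_of_adjacent_swaps (Q : seq L -> Prop) :
  (forall s1 a b s2, Q (s1 ++ a :: b :: s2) -> Q (s1 ++ b :: a :: s2)) ->
  forall s s', perm_eq s s' -> Q s -> Q s'.
Proof.
move=> sw.
have front s1 p x s2 : Q (p ++ s1 ++ x :: s2) -> Q (p ++ x :: s1 ++ s2).
  elim/last_ind: s1 s2 => [|s1 y IH] s2 //.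
  by rewrite cat_rcons catA => /sw; rewrite -catA cat_rcons => /IH.
suff gen s s' p : perm_eq s s' -> Q (p ++ s) -> Q (p ++ s').
  by move=> s s'; exact: (gen s s' [::]).
elim: s' s p => [|x s' IH] s p; first by move/perm_nilP => ->.
move=> pss Qs; have xs : x \in s by rewrite (perm_mem pss) mem_head.
case/splitPr: xs pss Qs => p1 p2 pss /front; rewrite -!cat_rcons; apply: IH.
by move: pss; rewrite (perm_catCA p1 [:: x] p2) perm_cons.
Qed.

End AdjacentSwaps.

Section Words.
Variables (k : fieldType) (d : nat).
Local Notation T := (tensor_basis d).
Local Notation M := 'M[k]_((tdim d).+1).
Local Notation letter := (bool * bool)%type.

(* A pair of basis tensors [(u, w)] is a word in the letters [(u x, w x)]. *)
Definition read (pr : letter -> bool) (s : seq letter) : T :=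
  [ffun x : 'I_d => pr (nth (false, false) s x)].

Definition word_entry (X : M) (s : seq letter) : k :=
  entry X (read fst s) (read snd s).

Lemma read_swap pr s1 a b s2 (i j : 'I_d) :
  nat_of_ord i = size s1 -> nat_of_ord j = i.+1 ->
  read pr (s1 ++ b :: a :: s2) = swap i j (read pr (s1 ++ a :: b :: s2)).
Proof.
move=> is1 ji; apply/ffunP => x; rewrite !ffunE; congr (pr _).
rewrite !nth_cat; case: tpermP => [->|->|/eqP ni /eqP nj].
- by rewrite ji is1 ltnn subnn ltnNge leqnSn subSn // subnn.
- by rewrite ji is1 ltnn subnn ltnNge leqnSn subSn // subnn.
case: ltnP => // xs; move: ni nj; rewrite -!val_eqE /= ji is1 => ni nj.
by have [y ->] : exists y, (x - size s1 = y.+2)%N by exists (x - size s1 - 2)%N; lia.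
Qed.

Lemma word_entry_swap (X : M) s1 a b s2 : X \in @schur_pred k d ->
  size (s1 ++ a :: b :: s2) = d ->
  word_entry X (s1 ++ b :: a :: s2) =
  (-1) ^+ (a.1 && b.1) * (-1) ^+ (a.2 && b.2) * word_entry X (s1 ++ a :: b :: s2).
Proof.
rewrite size_cat /= => XS sz.
have id : (size s1 < d)%N by lia.
have jd : ((size s1).+1 < d)%N by lia.
pose i := Ordinal id; pose j := Ordinal jd.
rewrite /word_entry !(@read_swap _ s1 a b s2 i j) // entry_swap //.
by rewrite !ffunE !nth_cat /= ltnn subnn ltnNge leqnSn subSn // subnn.
Qed.

Definition word_of (u w : T) : seq letter := [seq (u x, w x) | x <- enum 'I_d].

Lemma size_word_of u w : size (word_of u w) = d.
Proof. by rewrite size_map size_enum_ord. Qed.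

Lemma read_word_of u w : read fst (word_of u w) = u /\ read snd (word_of u w) = w.
Proof.
by split; apply/ffunP => x; rewrite ffunE (nth_map x) ?size_enum_ord // nth_ord_enum.
Qed.

Lemma weight_read pr s : size s = d -> weight (read pr s) = count pr s.
Proof.
move=> sd; rewrite -sum1_count (big_nth (false, false)) sd big_mkord big_mkcond.
by apply: eq_bigr => x _; rewrite ffunE; case: (pr _).
Qed.

(** Representative of the words with [i] odd letters in [u], where [s] and [t] count the two kinds
    of mixed letters. The mixed letters are adjacent, at the places where [mon i s t] acts. *)
Definition canon (i : nat) (s t : bool) : seq letter :=
  nseq (i - t) (true, true) ++ nseq s (false, true) ++ nseq t (true, false) ++
  nseq (d - i - s) (false, false).

Lemma size_canon i s t : (i <= d)%N -> valid d i s t -> size (canon i s t) = d.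
Proof.
rewrite /valid !size_cat !size_nseq; case: s; case: t => //=; lia.
Qed.

Lemma weight_upper i s t : (i <= d)%N -> valid d i s t ->
  weight (read fst (canon i s t)) = i.
Proof.
move=> id v; rewrite weight_read ?size_canon // !count_cat !count_nseq /=.
by move: v; rewrite /valid; case: s; case: t => //=; lia.
Qed.

Lemma weight_lower i s t : (i <= d)%N -> valid d i s t ->
  (weight (read snd (canon i s t)) + t = i + s)%N.
Proof.
move=> id v; rewrite weight_read ?size_canon // !count_cat !count_nseq /=.
by move: v; rewrite /valid; case: s; case: t => //=; lia.
Qed.

Lemma nth_canon i s t x : valid d i s t -> (x < d)%N ->
  nth (false, false) (canon i s t) x =
  ((x < i - t)%N || t && (x == i - t + s)%N, (x < i - t + s)%N).
Proof.
move=> v xd; rewrite !nth_cat !nth_nseq !size_nseq.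
have [xi|xi] := ltnP x (i - t); first by rewrite (leq_trans xi) ?leq_addr.
have [xs|xs] := ltnP (x - (i - t)) s.
  have -> : (x < i - t + s)%N by lia.
  by rewrite ltn_eqF ?andbF //; lia.
have -> : (x < i - t + s)%N = false by lia.
have [xt|xt] := ltnP (x - (i - t) - s) t.
  by have [-> ->] : t /\ (x == i - t + s)%N by lia.
rewrite if_same; case: t {v} xi xt xs => //= xi xt xs.
by rewrite gtn_eqF //; lia.
Qed.

Lemma word_entry_double (X : M) a s : (2%:R : k) != 0 -> X \in @schur_pred k d ->
  a.1 (+) a.2 -> size [:: a, a & s] = d -> word_entry X [:: a, a & s] = 0.
Proof.
move=> two XS a12 sz; have := @word_entry_swap X [::] a a s XS sz.
have -> : (-1) ^+ (a.1 && a.1) * (-1) ^+ (a.2 && a.2) = -1 :> k.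
  by case: a a12 {sz} => [[] []] //= _; rewrite expr0 expr1 ?mulr1 ?mul1r.
rewrite mulN1r /= => /eqP; rewrite -subr_eq0 opprK -mulr2n -mulr_natl mulf_eq0.
by rewrite (negPf two) => /eqP.
Qed.

Lemma size_letters (s : seq letter) :
  size s = (count_mem (true, true) s + count_mem (false, true) s +
            count_mem (true, false) s + count_mem (false, false) s)%N.
Proof. by elim: s => //= -[[] []] s -> /=; lia. Qed.

Lemma perm_letters (s s' : seq letter) :
  (forall a b, count_mem (a, b) s = count_mem (a, b) s') -> perm_eq s s'.
Proof. by move=> h; apply/allP => -[a b] _ /=; rewrite h. Qed.

(** Vanishing of an entry depends only on the letter counts of its word. A repeated mixed letter
    makes the entry 0, and every other word is a permutation of a canonical one. *)
Lemma schur_separation (X : M) : (2%:R : k) != 0 -> X \in @schur_pred k d ->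
  (forall i s t, (i <= d)%N -> valid d i s t -> word_entry X (canon i s t) = 0) ->
  X = 0.
Proof.
move=> two XS Xcanon; apply: entry_ext => u w; rewrite [RHS]mxE.
pose Q s := size s = d -> word_entry X s = 0.
suff : Q (word_of u w).
  rewrite /Q /word_entry; have [-> ->] := read_word_of u w.
  by apply; exact: size_word_of.
have := size_word_of u w; move: (word_of u w) => s sd.
have QP : forall s1 s2, perm_eq s1 s2 -> Q s1 -> Q s2.
  apply: perm_of_adjacent_swaps => s1 a b s2 Qs sz.
  have sz' : size (s1 ++ a :: b :: s2) = d by rewrite -sz !size_cat.
  by rewrite word_entry_swap // Qs // mulr0.
(* Exchanging two equal mixed letters changes the sign of the entry. *)
have double a : a.1 (+) a.2 -> (1 < count_mem a s)%N -> Q s.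
  move=> a12 ca; have pa : perm_eq [:: a, a & rem a (rem a s)] s.
    have as1 : a \in s by rewrite -has_pred1 has_count ltnW.
    have as2 : a \in rem a s.
      by rewrite -has_pred1 has_count count_mem_rem eqxx; lia.
    by rewrite perm_sym (permPl (perm_to_rem as1)) perm_cons perm_to_rem.
  by apply: (QP _ _ pa) => sz; apply: word_entry_double.
have [c01|/double] := leqP (count_mem (false, true) s) 1; last exact.
have [c10|/double] := leqP (count_mem (true, false) s) 1; last exact.
have sl := size_letters s; rewrite sd in sl.
pose i := (count_mem (true, true) s + count_mem (true, false) s)%N.
pose b01 := (0 < count_mem (false, true) s)%N.
pose b10 := (0 < count_mem (true, false) s)%N.
have v : valid d i b01 b10.
  by rewrite /valid /i /b01 /b10; apply/andP; split; apply/implyP; lia.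
apply: (QP (canon i b01 b10)); last
  by move=> _; apply: Xcanon => //; rewrite /i; lia.
apply: perm_letters => a b; rewrite !count_cat !count_nseq /= /i /b01 /b10.
move: sl c01 c10; case: a; case: b; rewrite !xpair_eqE;
  move: (count_mem (true, true) s) (count_mem (false, true) s)
        (count_mem (true, false) s) (count_mem (false, false) s);
  by move=> n11 n01 n10 n00 /=; lia.
Qed.

End Words.

(** * Coordinates dual to the monomials in the Schur superalgebra *)

Section Coordinates.
Variables (k : fieldType) (d : nat).
Hypotheses (two : (2%:R : k) != 0) (d0 : d%:R = 0 :> k).
Local Notation T := (tensor_basis d).
Local Notation M := 'M[k]_((tdim d).+1).
Local Notation smon := (mon (weight_proj k d) (annih k d) (creat k d)).

Let zz := schur_zigzag two d0.

Lemma entry_proj_mul i (Y : M) u w :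
  entry (weight_proj k d i * Y) u w = (weight u == i)%:R * entry Y u w.
Proof. by rewrite entry_monomialM. Qed.

Lemma entry_mul_proj i (Y : M) u w :
  entry (Y * weight_proj k d i) u w = entry Y u w * (weight w == i)%:R.
Proof. by rewrite entryM_monomial. Qed.

Lemma entry_sum (I : finType) (F : I -> M) u w :
  entry (\sum_i F i) u w = \sum_i entry (F i) u w.
Proof. by rewrite /entry summxE. Qed.

Lemma entry_mon_weight i s t u w : entry (smon i s t) u w != 0 ->
  weight u = i /\ (i + s = weight w + t)%N.
Proof.
move=> nz; split.
  by apply/eqP; apply: contraNT nz => ui;
     rewrite /mon -mulrA entry_proj_mul (negPf ui) mul0r.
apply/eqP; apply: contraNT nz => ws.
have := mon_mul zz i s t (weight w) false false.
rewrite (negPf ws) /= {2}/mon !expr0 !mulr1 => /(congr1 (fun X => entry X u w)).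
by rewrite entry_mul_proj eqxx mulr1 => ->; rewrite /entry mxE.
Qed.

Lemma entry_fermi_sum (R : rel 'I_d) b x w :
  entry (\sum_y fermi k R b y) (flip x w) w =
  if w x == b then (-1) ^+ odd_before R x w else 0.
Proof.
rewrite entry_sum (bigD1 x) //= big1 ?addr0 => [|y nyx].
  by rewrite entry_monomial eqxx.
by rewrite entry_monomial (inj_eq (@flip_inj _ w)) eq_sym (negPf nyx).
Qed.

(** No cancellation occurs: place [y] has to become odd, which only the creation term at [y] can
    achieve, and then annihilation must take place at [x]. *)
Lemma entry_annih_creat x y (w : T) : x != y -> w x -> ~~ w y ->
  entry (annih k d * creat k d) (flip x (flip y w)) w != 0.
Proof.
move=> xy wx wy; rewrite /creat mulr_sumr entry_sum (bigD1 y) //= big1 => [|z zy].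
  rewrite entryM_monomial entry_fermi_sum ffunE (negPf xy) addbF wx (negPf wy) /=.
  by rewrite addr0 mulf_neq0 ?signr_eq0.
rewrite entryM_monomial; have [wz|] := boolP (w z); first by rewrite mulr0.
rewrite /annih entry_sum big1 ?mul0r // => a _; rewrite entry_monomial.
case: eqP => // /ffunP /(_ y); rewrite !ffunE eqxx (negPf wy) !(eq_sym y).
rewrite (negPf xy) (negPf zy) !addbF => /esym /= /eqP ->.
by rewrite (negPf wy) ?ffunE (eq_sym y z) (negPf zy).
Qed.

Lemma entry_mon_canon i s t : (i <= d)%N -> valid d i s t ->
  word_entry (smon i s t) (canon d i s t) != 0.
Proof.
move=> id v; rewrite /word_entry /mon -mulrA entry_proj_mul weight_upper //.
rewrite eqxx mul1r.
case: s t v => [] [] v; rewrite ?expr0 ?expr1 ?mulr1 ?mul1r.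
- have [i0 i1] : (i.-1 < d)%N /\ (i < d)%N by move: v; rewrite /valid /=; lia.
  have i_gt0 : (0 < i)%N by move: v; rewrite /valid /=; lia.
  pose x := Ordinal i0; pose y := Ordinal i1.
  have -> : read d fst (canon d i true true) =
            flip x (flip y (read d snd (canon d i true true))).
    apply/ffunP => z; rewrite !ffunE nth_canon //= -!val_eqE /=; lia.
  apply: entry_annih_creat; rewrite ?ffunE ?nth_canon //= -?val_eqE /=; lia.
- have i1 : (i < d)%N by move: v; rewrite /valid /=; lia.
  pose x := Ordinal i1.
  have -> : read d fst (canon d i true false) =
            flip x (read d snd (canon d i true false)).
    apply/ffunP => z; rewrite !ffunE nth_canon //= -!val_eqE /=; lia.
  rewrite entry_fermi_sum ffunE nth_canon //= subn0 addn1 ltnSn eqxx.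
  by rewrite signr_eq0.
- have i1 : (i.-1 < d)%N by move: v; rewrite /valid /=; lia.
  have i_gt0 : (0 < i)%N by move: v; rewrite /valid /=; lia.
  pose x := Ordinal i1.
  have -> : read d fst (canon d i false true) =
            flip x (read d snd (canon d i false true)).
    apply/ffunP => z; rewrite !ffunE nth_canon //= -!val_eqE /=; lia.
  rewrite entry_fermi_sum ffunE nth_canon //= subn1 addn0 ltnn eqxx.
  by rewrite signr_eq0.
rewrite -monomial1 entry_monomial; case: (read d fst _ =P _) => [_|[]]; first
  exact: oner_neq0.
by apply/ffunP => z; rewrite !ffunE nth_canon //= addn0 orbF.
Qed.

(** Weights force [i = j] and [s - t = s' - t'], so the two triples differ only by exchanging no
    operator with both. The hypothesis excludes one order; in the other the monomial is diagonal
    while the word has mixed letters. *)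
Lemma entry_mon_canon_neq i s t j s' t' : (i <= d)%N -> valid d i s t ->
  (s || t) || ~~ (s' && t') -> (i, s, t) != (j, s', t') ->
  word_entry (smon j s' t') (canon d i s t) = 0.
Proof.
move=> id v st neq; apply/eqP/negPn/negP => nz.
have [] := entry_mon_weight nz; rewrite weight_upper // => ij.
have wl := weight_lower id v.
subst j => ws; have ss' : (s + t' = s' + t)%N by lia.
case: s t s' t' v st neq nz ss' {wl ws} => [] [] [] [] // v _;
  rewrite ?eqxx // => _ + _.
rewrite /mon !expr0 !mulr1 /word_entry entry_monomial.
case: (read d fst _ =P _) => [/ffunP e _|_]; last by rewrite eqxx.
have i1 : (i < d)%N by move: v; rewrite /valid /=; lia.
by have := e (Ordinal i1); rewrite !ffunE nth_canon //=;
   move: v; rewrite /valid /=; lia.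
Qed.

Local Notation index := ('I_d.+1 * bool * bool)%type.

Definition raw_coord i s t (X : M) : k :=
  if valid d i s t then
    word_entry X (canon d i s t) / word_entry (smon i s t) (canon d i s t)
  else 0.

(* The canonical word of [(i, false, false)] also occurs in the monomial
   [(i, true, true)], whose contribution has to be removed. *)
Definition coord (J : index) (X : M) : k :=
  let: (i, s, t) := J in
  if s || t then raw_coord i s t X else
  raw_coord i s t X -
    raw_coord i s t (smon i true true) * raw_coord i true true X.

Lemma raw_coord_linear i s t z X Y :
  raw_coord i s t (z *: X + Y) = z * raw_coord i s t X + raw_coord i s t Y.
Proof.
rewrite /raw_coord; case: ifP => _; last by rewrite mulr0 addr0.
by rewrite /word_entry /entry !mxE mulrDl mulrA.
Qed.

Lemma coord_linear J z X Y : coord J (z *: X + Y) = z * coord J X + coord J Y.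
Proof.
case: J => [[i s] t]; rewrite /coord !raw_coord_linear; case: ifP => _ //; ring.
Qed.

Lemma raw_coord_mon i s t j s' t' : (i <= d)%N -> valid d j s' t' ->
  (s || t) || ~~ (s' && t') ->
  raw_coord i s t (smon j s' t') = ((i, s, t) == (j, s', t'))%:R.
Proof.
move=> id v' st; rewrite /raw_coord.
have [e|ne] := eqVneq (i, s, t) (j, s', t').
  by case: e id => -> -> -> jd; rewrite v' divff // entry_mon_canon.
by case: ifP => // v; rewrite entry_mon_canon_neq // mul0r.
Qed.

Lemma coord_mon (J K : index) : valid d K.1.1 K.1.2 K.2 ->
  coord J (smon K.1.1 K.1.2 K.2) = (J == K)%:R.
Proof.
case: J K => [[i s] t] [[j s'] t'] /= v.
have id : (i <= d)%N by rewrite -ltnS.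
have eIJ : ((i, s, t) == (j, s', t')) = ((i : nat, s, t) == (j : nat, s', t')).
  by [].
case: ifP => st; first by rewrite raw_coord_mon ?st.
(* The only overlap is a coordinate [(i, false, false)] evaluated at a monomial [(j, true, true)].
   The correction term cancels it for [i = j], and weights exclude it otherwise. *)
have [/andP [ss' tt']|st'] := boolP (s' && t'); last first.
  rewrite [X in _ * X]raw_coord_mon ?orbT // raw_coord_mon ?st' ?orbT //.
  case: ((i : nat, true, true) =P _) => [[_ ss tt]|_]; last by rewrite mulr0 subr0.
  by rewrite -ss -tt in st'.
rewrite [X in _ - _ * X]raw_coord_mon //.
case: s' t' ss' tt' v eIJ => [] [] // _ _ v ->; case: s t st => [] [] // _.
rewrite !xpair_eqE !andbF !andbT; case: eqP => [<-|ij].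
  by rewrite mulr1 subrr.
rewrite mulr0n mulr0 subr0 /raw_coord /=.
have [->|] := eqVneq (word_entry (smon j true true) (canon d i false false)) 0.
  by rewrite mul0r.
by move=> /entry_mon_weight [] ; rewrite weight_upper.
Qed.

Lemma coord_invalid (J : index) X : ~~ valid d J.1.1 J.1.2 J.2 -> coord J X = 0.
Proof.
by case: J => [[i [] ] []] /= v; rewrite /coord /= /raw_coord ?(negPf v) //.
Qed.

(** The correction is triangular: the raw coordinates with [s || t] vanish first, then the
    others. *)
Lemma coord_eq0 (X : M) : (forall J, coord J X = 0) -> X \in @schur_pred k d ->
  X = 0.
Proof.
move=> c0 XS; apply: schur_separation => // i s t id v.
have raw0 s1 t1 : raw_coord i s1 t1 X = 0.
  have st0 s2 t2 : s2 || t2 -> raw_coord i s2 t2 X = 0.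
    by move=> st; have := c0 (Ordinal (id : (i < d.+1)%N), s2, t2); rewrite /= st.
  have [/st0 //|st] := boolP (s1 || t1).
  have := c0 (Ordinal (id : (i < d.+1)%N), s1, t1).
  by rewrite /= (negPf st) (st0 true true) // mulr0 subr0.
have /eqP := raw0 s t; rewrite /raw_coord v mulf_eq0 invr_eq0.
by rewrite (negPf (entry_mon_canon id v)) orbF => /eqP.
Qed.

Local Notation A := (schur_superalg k d).

Definition weight_elt i : A := SchurElt (weight_proj_in_schur k d i).
Definition annih_elt : A := SchurElt (annih_in_schur k d).
Definition creat_elt : A := SchurElt (creat_in_schur k d).

Lemma schur_valM (x y : A) : val (x * y) = val x * val y.
Proof. by []. Qed.

Lemma schur_val_sum (I : finType) (F : I -> A) :
  val (\sum_i F i) = \sum_i val (F i).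
Proof. by elim/big_rec2: _ => // i y x _ <-. Qed.

Lemma schur_elt_zigzag : zigzag d weight_elt annih_elt creat_elt.
Proof.
split=> [i j||i di|i||i||||]; apply: val_inj.
- by rewrite schur_valM (zz_idem zz); case: ifP.
- by rewrite schur_val_sum (zz_one zz).
- by rewrite /= (zz_out zz).
- by rewrite !schur_valM (zz_al zz).
- by rewrite !schur_valM (zz_al0 zz).
- by rewrite !schur_valM (zz_be zz).
- by rewrite !schur_valM (zz_be0 zz).
- by rewrite !schur_valM (zz_al2 zz).
- by rewrite !schur_valM (zz_be2 zz).
- by rewrite !schur_valM (zz_comm zz).
Qed.

Lemma val_mon i s t :
  val (mon weight_elt annih_elt creat_elt i s t) = smon i s t.
Proof. by rewrite /mon !schur_valM; case: s; case: t. Qed.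

Lemma schur_mon_basis :
  mon_basis weight_elt annih_elt creat_elt (fun J (x : A) => coord J (val x)).
Proof.
split.
- by move=> J z x y; rewrite -coord_linear.
(* Spanning follows from separation: [x] and [S] have the same coordinates, so their difference,
   which lies in the commutant, is 0. *)
- move=> x; set S := \sum_J _; apply/eqP; rewrite -subr_eq0 addrC -scaleN1r.
  apply/eqP/val_inj/coord_eq0; last exact: valP.
  move=> J; rewrite [LHS](coord_linear J (-1) (val S) (val x)) mulN1r addrC.
  apply/eqP; rewrite subr_eq0 /S schur_val_sum; apply/eqP.
  have coord0 : coord J 0 = 0.
    by have := coord_linear J (-1) 0 0; rewrite scaleN1r addr0 oppr0 mulN1r addNr.
  have coordD X Y : coord J (X + Y) = coord J X + coord J Y.
    by rewrite -[X]scale1r coord_linear mul1r scale1r.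
  have coordZ z X : coord J (z *: X) = z * coord J X.
    by rewrite -[z *: X]addr0 coord_linear coord0 addr0.
  rewrite (big_morph _ coordD coord0) /=.
  rewrite (eq_bigr (fun K => if K == J then coord J (val x) else 0)) => [|K _].
    by rewrite -big_mkcond big_pred1_eq.
  transitivity (coord K (val x) * coord J (smon K.1.1 K.1.2 K.2)).
    by rewrite -coordZ -val_mon.
  have [v|v] := boolP (valid d K.1.1 K.1.2 K.2).
    rewrite coord_mon // eq_sym; case: eqP => [->|]; by rewrite ?mulr1 ?mulr0.
  by rewrite coord_invalid // mul0r; case: eqP => // <-; rewrite coord_invalid.
by move=> J K v; rewrite val_mon coord_mon.
Qed.

End Coordinates.

Theorem theorem4p1p3 (k : closedFieldType) (p : nat)
    (hp : p \in [pchar k]) (hp2 : (2 < p)%N)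
    (d : nat) (hd : (0 < d)%N) (hpd : (p %| d)%N) :
  isomorphic_to_tildeA (schur_superalg k d) d /\
  finite_rep_type (schur_superalg k d).
Proof.
have two : (2%:R : k) != 0.
  by rewrite -(dvdn_pcharf hp) gtnNdvd.
have d0 : d%:R = 0 :> k by apply/eqP; rewrite -(dvdn_pcharf hp).
have zz := schur_elt_zigzag two d0; have cP := schur_mon_basis two d0.
split; last exact: zigzag_finite_rep_type zz cP.
by do 3 eexists; exact: zigzag_presents zz cP.
Qed.
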